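(* Let $\mathbb{K}\mathcal{P}=\bigoplus_{n\ge 0}\mathbb{K}\{M_a : a\in P_n\}$, with $M_\epsilon$ identified with $1\in\mathbb{K}$, equipped with the product $\star$ and the coproduct $\Delta$ described in the context; call this ${\rm PFSym}$. Then ${\rm PFSym}$ is a cocommutative Hopf algebra with unit $M_\epsilon$ and counit $\varepsilon$ given by $\varepsilon(M_\epsilon)=1$ and $\varepsilon(M_a)=0$ for every nonempty parking function $a$.
   Context: $\mathbb{K}$ is a field of characteristic zero. Words. All words are finite words on positive integers. $\epsilon$ is the empty word, $\cdot$ denotes concatenation, and $l(a)$ is the length of $a$. For a word $w$ and an integer $k$, $w+k$ is the word obtained by adding $k$ to each letter of $w$. Parking functions. A word $a\in[n]^n$ is a parking function of length $n$ if its nondecreasing rearrangement $b_1\le\cdots\le b_n$ satisfies $b_i\le i$ for all $i$. $P_n$ is the set of parking functions of length $n$, $P_0=\{\epsilon\}$, and $P=\bigcup_{n\ge0}P_n$. LR-decomposition. Let $a=a_1\cdots a_n$ be a nonempty word. A position $i$ is a left-to-right minimum if $i=1$, or if $a_i<a_j$ for all $j<i$. Let $i_1<\cdots<i_s$ be these positions and set $i_{s+1}=n+1$. For $1\le j\le s$ let $w_j=a_{i_{s+1-j}}a_{i_{s+1-j}+1}\cdots a_{i_{s+2-j}-1}$. Then $F_a=(w_1,\dots,w_s)$, and $F_\epsilon=()$. Each $w_j$ begins with its minimal letter, $\min w_1<\cdots<\min w_s$, and $a=w_s\cdots w_2 w_1$. The sequence $F_a$ is identified with the set $\{w_1,\dots,w_s\}$.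 Conversely, let $S$ be a finite set of words such that each word begins with its minimal letter and the minima are pairwise distinct. Concatenating the words of $S$ in decreasing order of their minima gives the unique word whose LR-decomposition is $S$. For $S\subseteq F_a$, this word is called a subword $a'$ of $a$ with $F_{a'}=S$. Product. $M_a\star M_\epsilon=M_\epsilon\star M_a=M_a$. Let $a\in P_m$ and $b\in P_n$ with $m,n\ge1$. Let $R(a,b)$ be the set of all matchings (bipartite graphs with no two edges sharing a vertex, including the empty one) between the vertex sets $F_a$ and $F_b+m=\{w+m: w\in F_b\}$. For $\Theta\in R(a,b)$, let $F_a\Theta F_b$ be the set obtained from $F_a\cup(F_b+m)$ by replacing each pair $u,w+m$ that is an edge of $\Theta$ by the single word $u\cdot(w+m)$. This is the LR-decomposition of a unique parking function $a\Theta b\in P_{m+n}$. Define $M_a\star M_b=\sum_{\Theta\in R(a,b)}M_{a\Theta b}$, and extend bilinearly. Parkization. Let $a=a_1\cdots a_n$ be a word and put $d(a)=\min\{i : |\{j: a_j\le i\}|<i\}$. If $d(a)=n+1$, then ${\rm Park}(a)=a$. Otherwise let $\bar a$ be obtained from $a$ by decreasing by $1$ every letter greater than $d(a)$, and set ${\rm Park}(a)={\rm Park}(\bar a)$. Also ${\rm Park}(\epsilon)=\epsilon$. The result ${\rm Park}(a)$ is a parking function of length $l(a)$. Coproduct. $\Delta(M_a)=\sum M_{{\rm Park}(a')}\otimes M_{{\rm Park}(a'')}$, where the sum runs over ordered pairs $(a',a'')$ of subwords of $a$ with $F_{a'}\cap F_{a''}=\emptyset$ and $F_{a'}\cup F_{a''}=F_a$.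 Equivalently, it runs over all subsets $S\subseteq F_a$, with $F_{a'}=S$ and $F_{a''}=F_a\setminus S$. $\Delta$ is extended linearly. *)

(* Defs.v *)
From HB Require Import structures.
From mathcomp Require Import all_boot all_algebra.
From mathcomp Require Import zify finmap monalg.

Set Implicit Arguments.
Unset Strict Implicit.
Unset Printing Implicit Defensive.

Import GRing.Theory.

(* Hopf algebras whose underlying vector space is given with a basis: the     *)
(* space with basis B is {malg K[B]}, the basis vector of b is << b >>, and   *)
(* the tensor product of {malg K[A]} and {malg K[B]} is {malg K[A * B]}, with *)
(* << a >> (x) << b >> = << (a, b) >>.                                        *)

Section FreeModules.
Local Open Scope ring_scope.
Variable K : fieldType.

Definition linext (B : choiceType) (V : lmodType K) (f : B -> V)
    (x : {malg K[B]}) : V :=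
  \sum_(b <- msupp x) x@_b *: f b.

Definition bilext (A B : choiceType) (V : lmodType K) (f : A -> B -> V)
    (x : {malg K[A]}) (y : {malg K[B]}) : V :=
  linext (fun a => linext (f a) y) x.

Definition tens (A B : choiceType) (x : {malg K[A]}) (y : {malg K[B]}) :
    {malg K[(A * B)%type]} :=
  bilext (fun a b => << (a, b) >>) x y.

Definition tensmap (A B C D : choiceType)
    (f : {malg K[A]} -> {malg K[C]}) (g : {malg K[B]} -> {malg K[D]}) :
    {malg K[(A * B)%type]} -> {malg K[(C * D)%type]} :=
  linext (fun p => tens (f << p.1 >>) (g << p.2 >>)).

Definition tens_assoc (A B C : choiceType) :
    {malg K[(A * B * C)%type]} -> {malg K[(A * (B * C))%type]} :=
  linext (fun p => << (p.1.1, (p.1.2, p.2)) >>).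

Definition tens_swap (A B : choiceType) :
    {malg K[(A * B)%type]} -> {malg K[(B * A)%type]} :=
  linext (fun p => << (p.2, p.1) >>).

End FreeModules.

Section HopfAlgebras.
Local Open Scope ring_scope.
Variables (K : fieldType) (B : choiceType).

Notation H := {malg K[B]}.
Notation HH := {malg K[(B * B)%type]}.

Variables (mu : H -> H -> H) (u : H) (Delta : H -> HH) (eps : H -> K).

Definition is_algebra : Prop :=
  [/\ (forall x, linear (mu x)) /\ (forall y, linear (mu^~ y)),
      associative mu, left_id u mu & right_id u mu].

(* In the last two clauses K (x) H and H (x) K are identified with H. *)
Definition is_coalgebra : Prop :=
  [/\ linear Delta /\ scalar eps,
      forall x, tens_assoc (tensmap Delta id (Delta x))
                = tensmap id Delta (Delta x),
      forall x, linext (fun p : B * B => eps << p.1 >> *: (<< p.2 >> : H))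
                  (Delta x) = x
    & forall x, linext (fun p : B * B => eps << p.2 >> *: (<< p.1 >> : H))
                  (Delta x) = x].

Definition tens_mul : HH -> HH -> HH :=
  bilext (fun p q : B * B =>
    tens (mu << p.1 >> << q.1 >>) (mu << p.2 >> << q.2 >>)).

Definition is_bialgebra : Prop :=
  [/\ is_algebra, is_coalgebra,
      (forall x y, Delta (mu x y) = tens_mul (Delta x) (Delta y))
      /\ Delta u = tens u u
    & (forall x y, eps (mu x y) = eps x * eps y) /\ eps u = 1].

Definition mul_tens : HH -> H :=
  linext (fun p : B * B => mu << p.1 >> << p.2 >>).

Definition is_antipode (S : H -> H) : Prop :=
  [/\ linear S,
      forall x, mul_tens (tensmap S id (Delta x)) = eps x *: u
    & forall x, mul_tens (tensmap id S (Delta x)) = eps x *: u].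

Definition is_hopf_algebra : Prop := is_bialgebra /\ exists S, is_antipode S.

Definition is_cocommutative : Prop := forall x, tens_swap (Delta x) = Delta x.

End HopfAlgebras.

Notation word := (seq nat).

Implicit Types (a b w : word) (L : seq word).

Definition shift (k : nat) w : word := map (addn k) w.

Definition positive w := all (fun x => 0 < x) w.

Definition parking a :=
  all (fun x => 0 < x <= size a) a
  && all (fun i => nth 0 (sort leq a) i <= i.+1) (iota 0 (size a)).

Lemma parkingP a :
  reflect (positive a /\ forall i, i <= size a -> i <= count (leq^~ i) a)
          (parking a).
Proof.
have ss : sorted leq (sort leq a) by apply: sort_sorted; exact: leq_total.
have cs i : count (leq^~ i) a = count (leq^~ i) (sort leq a).
  by apply/permP; rewrite perm_sym; apply/permPl/perm_sort.
apply: (iffP andP) => [[/allP pa /allP sa]|[/allP pa ca]].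
- split=> [|i ia]; first by apply/allP => x /pa /andP[].
  have st : size (take i (sort leq a)) = i by rewrite size_takel // size_sort.
  rewrite cs -(cat_take_drop i (sort leq a)) count_cat.
  suff : all (leq^~ i) (take i (sort leq a)) by rewrite all_count st; lia.
  apply/(all_nthP 0) => j; rewrite st => ji.
  rewrite nth_take //; have := sa j; rewrite mem_iota; lia.
- split.
    apply/allP => x xa; rewrite pa //=.
    have /ca := leqnn (size a); have := count_size (leq^~ (size a)) a => h1 h2.
    have : all (leq^~ (size a)) a by rewrite all_count; lia.
    by move/allP; apply.
  apply/allP => i; rewrite mem_iota => ia; rewrite leqNgt; apply/negP => lt.
  have /ca : i.+1 <= size a by lia.
  rewrite cs -(cat_take_drop i (sort leq a)) count_cat.
  have -> : count (leq^~ i.+1) (drop i (sort leq a)) = 0.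
    apply/eqP; rewrite eqn0Ngt -has_count; apply/hasPn => x.
    case/(nthP 0) => j; rewrite size_drop size_sort => jl <-.
    rewrite nth_drop -ltnNge; apply: leq_trans lt _.
    apply: (sorted_leq_nth leq_trans leqnn) => //; rewrite ?inE ?size_sort.
    - by case/andP: ia.
    - by rewrite -ltn_subRL.
    - exact: leq_addr.
  rewrite addn0 => h; have := leq_trans h (count_size _ _).
  by rewrite size_takel ?ltnn // size_sort ltnW //; case/andP: ia.
Qed.

Record pf := Pf { pf_word :> word; pf_parking : parking pf_word }.
HB.instance Definition _ := [isSub for pf_word].
HB.instance Definition _ := [Choice of pf by <:].

Definition pf_nil : pf := @Pf [::] isT.

Lemma pf_positive (a : pf) : positive a.
Proof. by case/parkingP: (pf_parking a). Qed.

(* Positions are numbered from 0; position 0 satisfies lrmin vacuously. *)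
Definition lrmin a i := all (fun x => nth 0 a i < x) (take i a).

Definition lrpos a := [seq i <- iota 0 (size a) | lrmin a i].

Definition lrdec a : seq word :=
  rev [seq drop p.1 (take p.2 a)
      | p <- zip (lrpos a) (rcons (behead (lrpos a)) (size a))].

Definition minletter w := foldr minn (head 0 w) w.

(* The sets of words in play have pairwise distinct minima, so the word does  *)
(* not depend on the order in which the list L enumerates the set.            *)
Definition word_of L : word :=
  flatten (sort (fun v w => minletter w <= minletter v) L).

Notation nblocks a := (size (lrdec a)).
Definition block a (i : 'I_(nblocks a)) : word := nth [::] (lrdec a) i.
Arguments block : clear implicits.

Lemma perm_word_of L : perm_eq (word_of L) (flatten L).
Proof. by apply: perm_flatten; apply/permPl/perm_sort. Qed.

Lemma perm_lrdec a : perm_eq (flatten (lrdec a)) a.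
Proof.
rewrite /lrdec; set s := map _ _.
have -> : perm_eq (flatten (rev s)) a = perm_eq (flatten s) a.
  by apply: permPl; apply: perm_flatten; rewrite perm_rev.
suff -> : flatten s = a by [].
have cuts w n k ps : all (leq^~ n) (k :: ps) -> path leq k ps ->
    flatten [seq drop p.1 (take p.2 w) | p <- zip (k :: ps) (rcons ps n)]
    = drop k (take n w).
  elim: ps k => [|p ps IH] k /=; first by rewrite cats0.
  case/and3P => kn pn psn /andP[kp pp]; rewrite -/(zip _ _) IH /= ?pn //.
  have -> : take p w = take p (take n w) by rewrite take_takel.
  rewrite -[in RHS](cat_take_drop p (take n w)) drop_cat.
  case: ltnP => // h; rewrite [drop k (take p _)]drop_oversize //=.
  case: (leqP p (size (take n w))) => hp.
    by rewrite (_ : k - _ = 0) ?drop0 //; move: h; rewrite size_takel //; lia.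
  by rewrite [drop p _]drop_oversize // ltnW.
rewrite {}/s; case: a => [//|x a].
have -> : lrpos (x :: a) = 0 :: [seq i <- iota 1 (size a) | lrmin (x :: a) i].
  by rewrite /lrpos /=.
rewrite cuts.
- by rewrite drop0 take_size.
- by apply/allP => i; rewrite inE mem_filter mem_iota /=; lia.
- apply: path_filter; first exact: leq_trans.
  by have := iota_sorted 0 (size a).+1.
Qed.

Section Park.

Lemma defect_exists a : exists i, count (leq^~ i) a < i.
Proof. by exists (size a).+1; rewrite ltnS count_size. Qed.

Definition defect a : nat := ex_minn (defect_exists a).

Definition park_step a : word :=
  [seq if defect a < x then x.-1 else x | x <- a].

(* The letter sum bounds the number of steps needed; see parkE. *)
Fixpoint park_rec (k : nat) a : word :=
  if k is k'.+1 then
    if defect a == (size a).+1 then a else park_rec k' (park_step a)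
  else a.

Definition park a : word := park_rec (sumn a) a.

Lemma defect_le a : defect a <= (size a).+1.
Proof.
by rewrite /defect; case: ex_minnP => d _; apply; rewrite ltnS count_size.
Qed.

Lemma sumn_park_step a :
  defect a != (size a).+1 -> sumn (park_step a) < sumn a.
Proof.
move=> da; have {da} : defect a <= size a by have := defect_le a; lia.
rewrite /park_step /defect; case: ex_minnP => d dc _ da.
have : has (fun x => d < x) a.
  rewrite -[has _ _]negbK -all_predC; apply/negP.
  rewrite (eq_all (a2 := leq^~ d)) ?all_count; first by move/eqP => E; lia.
  by move=> x /=; lia.
elim: a {dc da} => //= x a IH; have le : sumn
  [seq if d < y then y.-1 else y | y <- a] <= sumn a.
  by elim: a {IH} => //= y a; case: ifP => _; lia.
by case/orP => [dx|/IH]; [rewrite dx; lia | case: ifP; lia].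
Qed.

Lemma park_rec_stable k a : sumn a <= k -> park_rec k a = park a.
Proof.
rewrite /park; elim/ltn_ind: k a => -[|k] IH a.
  by rewrite leqn0 => /eqP ->.
case E: (sumn a) => [|s] /= sk.
  by case: eqP => // /eqP /sumn_park_step; rewrite E.
case: eqP => // /eqP /sumn_park_step; rewrite E => lt.
by rewrite IH ?(IH s) //; lia.
Qed.

Lemma parkE a :
  park a = if defect a == (size a).+1 then a else park (park_step a).
Proof.
rewrite /park; case E: (sumn a) => [|s] /=.
  by case: eqP => // /eqP /sumn_park_step; rewrite E.
case: eqP => // /eqP /sumn_park_step; rewrite E => lt.
exact: park_rec_stable.
Qed.

Lemma park_parking a : positive a -> parking (park a).
Proof.
have [k] := ubnP (sumn a); elim: k a => // k IH a lek pa.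
rewrite parkE; case: eqP => [da|/eqP da].
  apply/parkingP; split=> // i ia; rewrite leqNgt; apply/negP => lt.
  by move: da; rewrite /defect; case: ex_minnP => d _ /(_ _ lt); lia.
apply: IH; first by have := sumn_park_step da; lia.
rewrite /park_step; have : 0 < defect a.
  by rewrite /defect; case: ex_minnP => d h _; apply: leq_ltn_trans h.
move=> d0; rewrite /positive all_map; apply/allP => x /(allP pa) /=.
by case: ifP; lia.
Qed.

End Park.

Section Subwords.
Variables (a : pf) (S : {set 'I_(nblocks a)}).

(* A subset of lrdec a is given by the set S of the indices of its blocks. *)
Definition subword : word := word_of [seq block a i | i in S].

Lemma subword_positive : positive subword.
Proof.
rewrite /positive /subword (perm_all _ (perm_word_of _)).
apply/allP => x /flattenP[w /imageP[i _ ->]] xw.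
apply: (allP (pf_positive a)); rewrite -(perm_mem (perm_lrdec a)).
by apply/flattenP; exists (block a i) => //; exact: mem_nth.
Qed.

Definition pf_park : pf := Pf (park_parking subword_positive).

End Subwords.

Section Matchings.
Variables a b : pf.

(* Blocks are named by their indices; an edge (i, j) joins block i of a to    *)
(* block j of b shifted by the length of a.                                   *)
Definition is_matching (T : {set 'I_(nblocks a) * 'I_(nblocks b)}) :=
  [forall e in T, forall f in T, (e.1 == f.1) || (e.2 == f.2) ==> (e == f)].

Definition matching := {T : {set _} | is_matching T}.

Definition glue_blocks (T : matching) : seq word :=
  [seq block a i | i in ~: [set e.1 | e in val T]]
  ++ [seq shift (size a) (block b j) | j in ~: [set e.2 | e in val T]]
  ++ [seq block a e.1 ++ shift (size a) (block b e.2) | e in val T].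

Definition glue_word (T : matching) : word := word_of (glue_blocks T).

Lemma perm_glue_word T : perm_eq (glue_word T) (a ++ shift (size a) b).
Proof.
apply: (perm_trans (perm_word_of _)); apply/permP => P.
have sumE (I : finType) (A : {set I}) (F : I -> word) :
    count P (flatten [seq F i | i in A]) = \sum_(i in A) count P (F i).
  by rewrite count_flatten sumnE -map_comp big_map big_enum.
have cL (Q : pred nat) (c : pf) :
    count Q c = \sum_(i < nblocks c) count Q (block c i).
  rewrite -(permP (perm_lrdec c) Q) count_flatten sumnE big_map.
  by rewrite (big_nth [::]) big_mkord.
rewrite /glue_blocks !flatten_cat !count_cat !sumE {sumE}.
under [X in _ + (_ + X)]eq_bigr do rewrite count_cat.
rewrite big_split /=.
have mT : {in val T &, forall e f, (e.1 == f.1) || (e.2 == f.2) -> e = f}.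
  move=> e f eT fT ef; apply/eqP.
  by have /forall_inP/(_ _ eT)/forall_inP/(_ _ fT)/implyP := valP T; apply.
have i1 : {in val T &, injective (fun e => e.1)}.
  by move=> e f eT fT ef; apply: mT; rewrite // ef eqxx.
have i2 : {in val T &, injective (fun e => e.2)}.
  by move=> e f eT fT ef; apply: mT; rewrite // ef eqxx orbT.
rewrite -(big_imset (fun i => count P (block a i)) i1) /=.
rewrite -(big_imset (fun j => count P (shift (size a) (block b j))) i2) /=.
have -> : count P (shift (size a) b)
    = \sum_(j < nblocks b) count P (shift (size a) (block b j)).
  by rewrite count_map cL; apply: eq_bigr => j _; rewrite count_map.
rewrite (cL P a).
rewrite [in RHS](bigID (mem [set e.1 | e in val T])) /=.
rewrite [X in _ = _ + X](bigID (mem [set e.2 | e in val T])) /=.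
have cE (I : finType) (A : {set I}) (F : I -> nat) :
    \sum_(i in ~: A) F i = \sum_(i | i \notin A) F i.
  by apply: eq_bigl => i; rewrite inE.
by rewrite !cE addnA addnC [RHS]addnACA.
Qed.

Lemma glue_parking T : parking (glue_word T).
Proof.
have pT := perm_glue_word T.
have [pa ca] := parkingP _ (pf_parking a).
have [pb cb] := parkingP _ (pf_parking b).
apply/parkingP; split.
  rewrite /positive (perm_all _ pT) all_cat [all _ a]pa /= all_map.
  by apply/allP => x /(allP pb) /=; lia.
move=> i; rewrite (perm_size pT) (permP pT) size_cat count_cat.
rewrite size_map count_map => le.
case: (leqP i (size a)) => [/ca h|ia]; first exact: leq_trans h (leq_addr _ _).
rewrite -[i in i <= _](subnKC (ltnW ia)); apply: leq_add.
  apply: leq_trans (ca _ (leqnn _)) _; apply: sub_count => x /= xa.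
  exact: leq_trans xa (ltnW ia).
have /cb : i - size a <= size b by rewrite leq_subLR.
by move/leq_trans; apply; apply: sub_count => x /=; lia.
Qed.

Definition pf_glue (T : matching) : pf := Pf (glue_parking T).

End Matchings.

Section PFSym.
Local Open Scope ring_scope.
Variable K : fieldType.

Definition pfsym := {malg K[pf]}.

Definition mul_basis (a b : pf) : pfsym :=
  if a == pf_nil then << b >>
  else if b == pf_nil then << a >>
  else \sum_(T : matching a b) << pf_glue T >>.

Definition pfsym_mul : pfsym -> pfsym -> pfsym := bilext mul_basis.

Definition pfsym_one : pfsym := << pf_nil >>.

Definition comul_basis (a : pf) : {malg K[(pf * pf)%type]} :=
  \sum_(S : {set 'I_(nblocks a)}) << (pf_park S, pf_park (~: S)) >>.

Definition pfsym_comul : pfsym -> {malg K[(pf * pf)%type]} :=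
  linext comul_basis.

Definition pfsym_counit : pfsym -> K :=
  linext (fun a : pf => (a == pf_nil)%:R : K^o).

End PFSym.

(* Main.v *)
Require Import Defs.
From HB Require Import structures.
From mathcomp Require Import all_boot all_algebra.
From mathcomp Require Import perm zify finmap monalg.

(* A parking function is the same thing as the set of its blocks. At the      *)
(* level of lists of blocks the product is a sum over matchings in which an   *)
(* edge contracts its ends by an associative operation, and the coproduct is  *)
(* a sum over splittings in two; associativity, coassociativity and the       *)
(* compatibility of the two are then identities between such sums, proved by  *)
(* induction on the lists. Parkization does not interfere with them because   *)
(* it relabels the letters increasingly, hence block by block, in such a way  *)
(* that Park(w') = Park(f w') when f is the relabelling of w and w' is part   *)
(* of w, and because it commutes with the shifted concatenation of a part of  *)
(* one parking function with a part of another. The bialgebra is graded by    *)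
(* length and connected, so it has an antipode.                               *)

Set Implicit Arguments.
Unset Strict Implicit.
Unset Printing Implicit Defensive.

Import GRing.Theory.

(** * Matchings and splittings of lists *)

(** A word is determined by its unordered set of blocks ([word_of_lrdec], [perm_lrdec_word_of]), so
    each law reduces to an identity between sums over lists of blocks taken up to permutation. Three
    such identities carry the bialgebra. In a triple product every resulting block is a chain with
    at most one block from each factor, whichever product is taken first ([glues_assoc]). Splitting
    twice distributes the blocks among three sides ([splits_coassoc]). Splitting after gluing sends
    both ends of an edge to the same side, so it amounts to splitting both factors and gluing side
    by side ([splits_glues]). [sum_gluings] and [sum_pf_park] pass from the index sets of the
    definitions to these lists.

    Parkization is a single relabelling [pk]: it lowers x by the largest deficiency, i minus the
    number of letters at most i, over i < x. It is increasing on the letters ([pk_incr]), so it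
    respects blocks. [park_map_pk] removes the inner one of two nested parkizations, whence
    [sum_splits_part]; [pk_catl] and [pk_catr] make parkization commute with shifted gluing, whence
    [sum_gluings_part].

    Cocommutativity exchanges a subset with its complement. The coproduct preserves total length and
    only the empty word has length zero, so [connected_antipode] inverts the identity for
    convolution by a series that is finite in each degree. *)

Section Combinatorics.
Variables (T : Type) (op : T -> T -> T).
Implicit Types (L M N R : seq T).

Fixpoint picks L : seq (T * seq T) :=
  if L is x :: L' then (x, L') :: [seq (p.1, x :: p.2) | p <- picks L']
  else [::].

(* All the lists obtained from L ++ M by a matching between L and M, each     *)
(* edge (u, v) of which is contracted to [op u v].                            *)
Fixpoint glues L M : seq (seq T) :=
  if L is u :: L' then
    [seq u :: R | R <- glues L' M]
    ++ flatten [seq [seq op u p.1 :: R | R <- glues L' p.2] | p <- picks M]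
  else [:: M].

(* All the pairs (S, complement of S) for S a subset of L. *)
Fixpoint splits L : seq (seq T * seq T) :=
  if L is u :: L' then
    [seq (u :: p.1, p.2) | p <- splits L']
    ++ [seq (p.1, u :: p.2) | p <- splits L']
  else [:: ([::], [::])].

Local Open Scope ring_scope.
Variable V : nmodType.

Lemma picks_nil (F : T * seq T -> V) : \sum_(p <- picks [::]) F p = 0.
Proof. by rewrite big_nil. Qed.

Lemma picks_cons x L (F : T * seq T -> V) :
  \sum_(p <- picks (x :: L)) F p
  = F (x, L) + \sum_(p <- picks L) F (p.1, x :: p.2).
Proof. by rewrite /= big_cons big_map. Qed.

Lemma glues_nil M (F : seq T -> V) : \sum_(R <- glues [::] M) F R = F M.
Proof. by rewrite big_seq1. Qed.

Lemma glues_cons u L M (F : seq T -> V) :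
  \sum_(R <- glues (u :: L) M) F R
  = \sum_(R <- glues L M) F (u :: R)
    + \sum_(p <- picks M) \sum_(R <- glues L p.2) F (op u p.1 :: R).
Proof.
rewrite /= big_cat big_map; congr (_ + _).
by rewrite big_flatten big_map; apply: eq_bigr => p _; rewrite big_map.
Qed.

Lemma splits_cons u L (H : seq T * seq T -> V) :
  \sum_(p <- splits (u :: L)) H p
  = \sum_(p <- splits L) H (u :: p.1, p.2)
    + \sum_(p <- splits L) H (p.1, u :: p.2).
Proof. by rewrite /= big_cat !big_map. Qed.

Lemma picksC N (F : T -> T -> seq T -> V) :
  \sum_(p <- picks N) \sum_(q <- picks p.2) F p.1 q.1 q.2
  = \sum_(p <- picks N) \sum_(q <- picks p.2) F q.1 p.1 q.2.
Proof.
elim: N F => [|x N IH] F; rewrite ?picks_nil // !picks_cons /=.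
under [X in _ + X = _]eq_bigr do rewrite picks_cons /=.
under [X in _ = _ + X]eq_bigr do rewrite picks_cons /=.
rewrite !big_split /= (IH (fun a b R => F a b (x :: R))).
by rewrite addrCA.
Qed.

(** An element of a gluing of M and N is an isolated element of M, an isolated element of N, or a
    contracted edge; the three sums on the right are these cases. *)
Lemma picks_glues M N (H : T -> seq T -> V) :
  \sum_(R <- glues M N) \sum_(p <- picks R) H p.1 p.2
  = \sum_(p <- picks M) \sum_(R <- glues p.2 N) H p.1 R
    + \sum_(q <- picks N) \sum_(R <- glues M q.2) H q.1 R
    + \sum_(p <- picks M) \sum_(q <- picks N)
        \sum_(R <- glues p.2 q.2) H (op p.1 q.1) R.
Proof.
elim: M N H => [|u M IH] N H.
  rewrite glues_nil !picks_nil addr0 add0r.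
  by apply: eq_bigr => p _; rewrite glues_nil.
rewrite glues_cons.
under eq_bigr do rewrite picks_cons /=.
under [X in _ + X = _]eq_bigr do under eq_bigr do rewrite picks_cons /=.
rewrite big_split /= (IH N (fun a R => H a (u :: R))).
under [X in _ + X = _]eq_bigr => p _ do
  rewrite big_split /= (IH p.2 (fun a R => H a (op u p.1 :: R))).
rewrite !big_split /= !picks_cons /=.
under [X in _ = _ + X + _ + _]eq_bigr do rewrite glues_cons.
under [X in _ = _ + X + _]eq_bigr do rewrite glues_cons.
under [X in _ = _ + (_ + X)]eq_bigr do under eq_bigr do rewrite glues_cons.
under [X in _ = _ + (_ + X)]eq_bigr do rewrite big_split /=.
rewrite !big_split /=.
rewrite [X in _ + (_ + (X + _ + _)) = _]exchange_big /=.
rewrite (picksC N (fun a b P => \sum_(R <- glues M P) H b (op u a :: R))).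
rewrite [X in _ + (_ + (_ + X)) = _]exchange_big /=.
under [X in _ + (_ + (_ + X)) = _]eq_bigr => p _ do
  rewrite (picksC N (fun a b P =>
             \sum_(R <- glues p.2 P) H (op p.1 b) (op u a :: R))).
by rewrite [LHS](AC (1*3*(1*3)) (1*(2*6)*(3*7)*(5*(4*8)))).
Qed.

(** Induction on L: on both sides the head u stays alone, or is joined to an element of M, to one of
    N, or to a chain made of one of each. Associativity of [op] is what identifies the last case. *)
Lemma glues_assoc L M N (F : seq T -> V) : associative op ->
  \sum_(R <- glues L M) \sum_(Q <- glues R N) F Q
  = \sum_(R <- glues M N) \sum_(Q <- glues L R) F Q.
Proof.
move=> opA; elim: L M N F => [|u L IH] M N F.
  by rewrite glues_nil; apply: eq_bigr => R _; rewrite glues_nil.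
rewrite glues_cons.
under eq_bigr do rewrite glues_cons.
under [X in _ + X = _]eq_bigr do under eq_bigr do rewrite glues_cons.
under [RHS]eq_bigr do rewrite glues_cons.
rewrite !big_split /= (IH _ _ (fun R => F (u :: R))) exchange_big /=.
under [X in _ + X + _ = _]eq_bigr => p _ do
  rewrite (IH _ _ (fun R => F (op u p.1 :: R))).
under [X in _ + X = _]eq_bigr do rewrite big_split /= exchange_big /=.
rewrite big_split /=.
under [X in _ + (X + _) = _]eq_bigr => p _ do
  rewrite (IH _ _ (fun R => F (op u p.1 :: R))).
under [X in _ + (_ + X) = _]eq_bigr => p _ do under eq_bigr => q _ do
  rewrite (IH _ _ (fun R => F (op (op u p.1) q.1 :: R))).
(* On the right u is joined to an element of a gluing of M and N; the three possible origins of this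
   element match the last three sums on the left. *)
rewrite (picks_glues M N (fun m R => \sum_(Q <- glues L R) F (op u m :: Q))).
under [X in _ = _ + (_ + X)]eq_bigr do under eq_bigr do
  under eq_bigr do under eq_bigr do rewrite opA.
by rewrite [LHS](AC (2*2) (1*(3*2*4))).
Qed.

Lemma splits_coassoc L (H : seq T -> seq T -> seq T -> V) :
  \sum_(p <- splits L) \sum_(q <- splits p.1) H q.1 q.2 p.2
  = \sum_(p <- splits L) \sum_(q <- splits p.2) H p.1 q.1 q.2.
Proof.
elim: L H => [|u L IH] H; first by rewrite !big_seq1.
rewrite !splits_cons /=.
under eq_bigr do rewrite splits_cons /=.
under [X in _ = _ + X]eq_bigr do rewrite splits_cons /=.
rewrite !big_split /= (IH (fun X Y Z => H (u :: X) Y Z)).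
rewrite (IH (fun X Y Z => H X (u :: Y) Z)) (IH (fun X Y Z => H X Y (u :: Z))).
by rewrite addrA.
Qed.

Lemma picks_splitsl M (H : T -> seq T -> seq T -> V) :
  \sum_(q <- splits M) \sum_(p <- picks q.1) H p.1 p.2 q.2
  = \sum_(p <- picks M) \sum_(q <- splits p.2) H p.1 q.1 q.2.
Proof.
elim: M H => [|u M IH] H; first by rewrite big_seq1 !picks_nil.
rewrite picks_cons !splits_cons /=.
under eq_bigr do rewrite picks_cons /=.
under [X in _ = _ + X]eq_bigr do rewrite splits_cons /=.
rewrite !big_split /= (IH (fun m X Y => H m (u :: X) Y)).
by rewrite (IH (fun m X Y => H m X (u :: Y))) addrA.
Qed.

Lemma picks_splitsr M (H : T -> seq T -> seq T -> V) :
  \sum_(q <- splits M) \sum_(p <- picks q.2) H p.1 q.1 p.2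
  = \sum_(p <- picks M) \sum_(q <- splits p.2) H p.1 q.1 q.2.
Proof.
elim: M H => [|u M IH] H; first by rewrite big_seq1 !picks_nil.
rewrite picks_cons !splits_cons /=.
under [X in _ + X = _]eq_bigr do rewrite picks_cons /=.
under [X in _ = _ + X]eq_bigr do rewrite splits_cons /=.
rewrite !big_split /= (IH (fun m X Y => H m (u :: X) Y)).
by rewrite (IH (fun m X Y => H m X (u :: Y))) addrCA.
Qed.

(** A contracted edge goes to one side as a whole. Hence a matching with a splitting of its result
    is the same as splittings of L and M with one matching on each side. *)
Lemma splits_glues L M (H : seq T -> seq T -> V) :
  \sum_(R <- glues L M) \sum_(p <- splits R) H p.1 p.2
  = \sum_(p <- splits L) \sum_(q <- splits M)
      \sum_(R <- glues p.1 q.1) \sum_(R' <- glues p.2 q.2) H R R'.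
Proof.
elim: L M H => [|u L IH] M H.
  rewrite glues_nil big_seq1; apply: eq_bigr => q _.
  by rewrite !glues_nil.
rewrite glues_cons splits_cons /=.
under eq_bigr do rewrite splits_cons /=.
under [X in _ + X = _]eq_bigr do under eq_bigr do rewrite splits_cons /=.
rewrite !big_split /= (IH _ (fun X Y => H (u :: X) Y)).
rewrite (IH _ (fun X Y => H X (u :: Y))).
under [X in _ + X = _]eq_bigr => p _ do
  rewrite big_split /= (IH _ (fun X Y => H (op u p.1 :: X) Y))
          (IH _ (fun X Y => H X (op u p.1 :: Y))).
rewrite big_split /=.
under [X in _ = X + _]eq_bigr do under eq_bigr do rewrite glues_cons.
under [X in _ = _ + X]eq_bigr do under eq_bigr do under eq_bigr do
  rewrite glues_cons.
rewrite [X in _ + (X + _) = _]exchange_big [X in _ + (_ + X) = _]exchange_big.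
rewrite addrACA; congr (_ + _); rewrite -big_split /=; apply: eq_bigr => p _.
  rewrite [RHS]big_split /=; congr (_ + _).
  by rewrite (picks_splitsl M (fun m X Y => \sum_(R <- glues p.1 X)
    \sum_(R' <- glues p.2 Y) H (op u m :: R) R')).
under [RHS]eq_bigr do rewrite big_split /= exchange_big /=.
rewrite big_split /=; congr (_ + _).
  by apply: eq_bigr => q _; rewrite exchange_big.
rewrite -(picks_splitsr M (fun m X Y => \sum_(R <- glues p.1 X)
  \sum_(R' <- glues p.2 Y) H R (op u m :: R'))).
by apply: eq_bigr => q _; rewrite exchange_big.
Qed.
End Combinatorics.

(** * Sums over sets of indices as sums over lists *)

Section Enumeration.
Local Open Scope ring_scope.
Variables (T : eqType) (op : T -> T -> T).

Lemma picks_uniq (I : eqType) (f : I -> T) (s : seq I) : uniq s ->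
  picks (map f s) = [seq (f j, map f (rem j s)) | j <- s].
Proof.
elim: s => //= x s IH /andP[xs us]; rewrite eqxx; congr (_ :: _).
rewrite (IH us) -map_comp; apply/eq_in_map => j js /=.
by case: eqP js xs => [-> ->|].
Qed.

Lemma sum_subsets (V : nmodType) (I : finType) (f : I -> T) (s : seq I)
    (H : seq T -> seq T -> V) : uniq s ->
  \sum_(S : {set I} | S \subset s)
    H [seq f i | i <- s & i \in S] [seq f i | i <- s & i \notin S]
  = \sum_(p <- splits (map f s)) H p.1 p.2.
Proof.
elim: s H => [|i s IH] H /=.
  move=> _; rewrite big_seq1 (big_pred1 set0) // => S /=.
  apply/subsetP/eqP => [h|->] => [|x]; last by rewrite inE.
  by apply/setP => x; rewrite inE; apply/negP => /h.
case/andP=> is_ us; rewrite -/(splits _) splits_cons.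
rewrite (bigID (fun S : {set I} => i \in S)) /=; congr (_ + _).
  rewrite (reindex_onto (fun S => i |: S) (fun S => S :\ i)) /=; last first.
    by move=> S /andP[_ iS]; rewrite setD1K.
  rewrite -(IH (fun X Y => H (f i :: X) Y) us).
  have sub (S : {set I}) : S \subset s -> i \notin S.
    by move=> /subsetP h; apply: contra is_ => /h.
  apply: eq_big => [S|S].
    apply/andP/idP => [[/andP[/subsetP h _] /eqP E]|h].
      have iS : i \notin S by rewrite -E !inE eqxx.
      apply/subsetP => x xS; have := h x; rewrite !inE xS orbT => /(_ isT).
      by case: eqP xS iS => // -> ->.
    rewrite setU11 setU1K ?sub // eqxx andbT; split=> //; apply/subsetP => x.
    by rewrite !inE => /predU1P[->|/(subsetP h) ->]; rewrite ?eqxx ?orbT.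
  case/andP=> _ /eqP E; have iS : i \notin S by rewrite -E !inE eqxx.
  rewrite !inE eqxx /=; congr (H (_ :: map f _) (map f _));
    by apply/eq_in_filter => x xs; rewrite !inE; case: eqP xs is_ => // -> ->.
rewrite -(IH (fun X Y => H X (f i :: Y)) us).
apply: eq_big => [S|S /andP[_ /negPf ->] //].
apply/andP/subsetP => [[/subsetP h iS] x xS|h].
  by have := h x xS; rewrite inE; case: eqP xS iS => // -> ->.
split; last by apply: contra is_ => /h.
by apply/subsetP => x /h xs; rewrite inE xs orbT.
Qed.

Section Matchings.
Variables (I J : finType).
Implicit Types (E : {set I * J}).

Definition matchset E :=
  [forall e in E, forall f in E, (e.1 == f.1) || (e.2 == f.2) ==> (e == f)].

Lemma matchsetP E :
  reflect {in E &, forall e f, e.1 = f.1 \/ e.2 = f.2 -> e = f} (matchset E).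
Proof.
apply: (iffP forall_inP) => h e.
  move=> f eE fE ef; apply/eqP; have /forall_inP/(_ f fE)/implyP := h e eE.
  by apply; case: ef => ->; rewrite eqxx ?orbT.
move=> eE; apply/forall_inP => f fE; apply/implyP => /orP ef; apply/eqP/h => //.
by case: ef => /eqP; [left|right].
Qed.

(** Confining the edges to sublists of indices is what makes induction on s possible; for full
    enumerations the condition is vacuous. *)
Definition within (s : seq I) (t : seq J) E :=
  [forall e in E, (e.1 \in s) && (e.2 \in t)].

Lemma withinP s t E :
  reflect (forall i j, (i, j) \in E -> i \in s /\ j \in t) (within s t E).
Proof.
apply: (iffP forall_inP) => [h i j /h /andP[]|h [i j] /h /andP] //.
Qed.

Lemma mem_dom E i : reflect (exists j, (i, j) \in E) (i \in [set e.1 | e in E]).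
Proof.
apply: (iffP imsetP) => [[[x j] xE ->]|[j ijE]]; first by exists j.
by exists (i, j).
Qed.

Lemma mem_codom E j :
  reflect (exists i, (i, j) \in E) (j \in [set e.2 | e in E]).
Proof.
apply: (iffP imsetP) => [[[i y] yE ->]|[i ijE]]; first by exists i.
by exists (i, j).
Qed.

Variables (f : I -> T) (g : J -> T).

Definition glueset (s : seq I) (t : seq J) E : seq T :=
  [seq f i | i <- s & i \notin [set e.1 | e in E]]
  ++ [seq g j | j <- t & j \notin [set e.2 | e in E]]
  ++ [seq op (f e.1) (g e.2) | e in E].

Lemma glueset_edge s t E i j : i \notin s -> uniq t -> j \in t ->
    (i, j) \notin E ->
  perm_eq (glueset (i :: s) t ((i, j) |: E))
          (op (f i) (g j) :: glueset s (rem j t) E).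
Proof.
move=> is_ ut jt ijE; rewrite /glueset /= rem_filter //.
have -> : i \in [set e.1 | e in (i, j) |: E].
  by apply/mem_dom; exists j; rewrite setU11.
set A := filter _ s; set A' := filter _ s; have -> : A = A'.
  apply/eq_in_filter => x xs; congr (~~ _).
  apply/mem_dom/mem_dom => [[y]|[y xy]]; last first.
    by exists y; rewrite inE xy orbT.
  rewrite !inE xpair_eqE; case: eqP xs is_ => [-> ->|_ _ _] //= xy.
  by exists y.
set B := [seq j0 <- t | j0 \notin _]; set B' := filter _ (filter _ _).
have -> : B = B'.
  rewrite /B' -filter_predI; apply/eq_in_filter => y yt /=; apply/idP/andP.
    move=> h; split; apply: contra h.
      by case/mem_codom=> x xy; apply/mem_codom; exists x; rewrite inE xy orbT.
    by move/eqP->; apply/mem_codom; exists i; rewrite setU11.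
  case=> h yj; apply: contra h => /mem_codom[x].
  rewrite !inE xpair_eqE (negPf yj) andbF => xy.
  by apply/mem_codom; exists x.
have pE : perm_eq (enum ((i, j) |: E)) ((i, j) :: enum E).
  apply: uniq_perm; rewrite /= ?enum_uniq ?mem_enum ?ijE // => e.
  by rewrite mem_enum !inE mem_enum.
have {pE} := perm_map (fun e => op (f e.1) (g e.2)) pE.
rewrite -(perm_cat2l ([seq f i | i <- A'] ++ [seq g j | j <- B'])) -!catA.
by move/permPl->; rewrite /= !catA perm_sym -cat1s perm_catCA.
Qed.

(** Either the head i of s is isolated, or it has a unique partner j, and removing the edge leaves a
    matching between the tail of s and t without j. The two sides list the blocks in different
    orders, which is why F has to be invariant under permutation. *)
Lemma sum_matchings (V : nmodType) s t (F : seq T -> V) : uniq s -> uniq t ->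
    (forall R R', perm_eq R R' -> F R = F R') ->
  \sum_(E | matchset E && within s t E) F (glueset s t E)
  = \sum_(R <- glues op (map f s) (map g t)) F R.
Proof.
elim: s t F => [|i s IH] t F /=.
  move=> _ _ _; rewrite big_seq1 (big_pred1 set0) => [|E].
    congr F; rewrite /glueset /=.
    rewrite (eq_filter (a2 := predT)) ?filter_predT
      /image_mem ?enum_set0 ?cats0 //.
    by move=> j /=; apply/mem_codom => -[x]; rewrite inE.
  apply/andP/eqP => [[_ /withinP h]|->].
    by apply/setP => -[x y]; rewrite inE; apply/negP => /h[].
  by split; [apply/matchsetP => e f0|apply/withinP => x y]; rewrite inE.
case/andP=> is_ us ut Fp; rewrite -/(glues _ _ _) glues_cons.
rewrite (bigID (fun E => i \notin [set e.1 | e in E])) /=; congr (_ + _).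
  rewrite -(IH t (fun R => F (f i :: R))) //; last first.
    by move=> R R' pR; apply: Fp; rewrite perm_cons.
  apply: eq_big => [E|E /andP[_ iE]]; last by rewrite /glueset /= iE.
  rewrite -andbA; congr (_ && _).
  apply/andP/withinP => [[/withinP h iE] x y xy|h].
    have [] := h _ _ xy; rewrite inE => /predU1P[xi|]; last by [].
    by case/negP: iE; apply/mem_dom; exists y; rewrite -xi.
  split; first by apply/withinP => x y /h[xs yt]; rewrite inE xs orbT.
  by apply: contra is_ => /mem_dom[y /h[]].
rewrite (picks_uniq _ ut) big_map /=.
(* Group the matchings that cover i by the partner j of i, which is unique. *)
transitivity (\sum_(j <- t) \sum_(E | matchset E && within (i :: s) t E
                                     && ((i, j) \in E))
                 F (glueset (i :: s) t E)).
  rewrite (exchange_big_dep (fun E => [&& matchset E, within (i :: s) t E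
     & i \in [set e.1 | e in E]])) /=; last first.
    move=> j E _ /andP[/andP[-> ->] ijE] /=; by apply/mem_dom; exists j.
  apply: eq_big => [E|E]; first by rewrite negbK andbA.
  case/andP=> /andP[mE wE]; rewrite negbK => /mem_dom[j0 ij0].
  rewrite -big_filter (eq_in_filter (a2 := pred1 j0)).
    have [_ j0t] := withinP _ _ _ wE _ _ ij0.
    by rewrite filter_pred1_uniq // big_seq1.
  move=> j jt; rewrite mE wE /=; apply/idP/eqP => [ij|->] //.
  by have [] : (i, j) = (i, j0) by apply: (matchsetP _ mE); auto.
apply: eq_big_seq => j jt.
rewrite -(IH (rem j t) (fun R => F (op (f i) (g j) :: R))) ?rem_uniq //;
  last by move=> R R' pR; apply: Fp; rewrite perm_cons.
rewrite (reindex_onto (fun E => (i, j) |: E) (fun E => E :\ (i, j))) /=;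
  last by move=> E /andP[_ iS]; rewrite setD1K.
have in_rem y : y \in rem j t = (y != j) && (y \in t).
  by rewrite rem_filter // mem_filter.
apply: eq_big => [E|E]; last first.
  case/andP=> _ /eqP EE; apply: Fp; apply: glueset_edge => //.
  by rewrite -EE !inE eqxx.
apply/andP/andP => [[/andP[/andP[mE wE] _] /eqP EE]|[mE wE]].
  have ijE : (i, j) \notin E by rewrite -EE !inE eqxx.
  have sE e : e \in E -> e \in (i, j) |: E by rewrite inE orbC => ->.
  split; first by apply/matchsetP => e e' /sE he /sE; apply: (matchsetP _ mE).
  apply/withinP => x y xy; have [] := withinP _ _ _ wE _ _ (sE _ xy).
  have ne : (x, y) <> (i, j) by move=> q; rewrite q (negPf ijE) in xy.
  rewrite inE in_rem => /orP xs ->; split.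
    case: xs => // /eqP xi; case: ne; apply: (matchsetP _ mE);
      rewrite ?setU11 ?sE //.
    by left.
  rewrite andbT; apply/eqP => yj; case: ne.
  by apply: (matchsetP _ mE); rewrite ?setU11 ?sE //; right.
have nE x y : (x, y) \in E -> x <> i /\ y <> j.
  move=> xy; have [xs] := withinP _ _ _ wE _ _ xy.
  rewrite in_rem => /andP[/eqP yj _]; split=> // xi.
  by rewrite xi (negPf is_) in xs.
have ijE : (i, j) \notin E by apply/negP => /nE[].
rewrite setU1K // setU11 eqxx andbT; split=> //; apply/andP; split.
  apply/matchsetP => -[x y] [x' y']; rewrite !inE.
  move=> /predU1P[[-> ->]|xy] /predU1P[[-> ->]|xy'] //=.
  - by case: (nE _ _ xy') => ne ne' [/esym|/esym].
  - by case: (nE _ _ xy) => ne ne' [].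
  - exact: (matchsetP _ mE (x, y) (x', y')).
apply/withinP => x y; rewrite !inE => /predU1P[[-> ->]|xy].
  by rewrite eqxx.
have [xs] := withinP _ _ _ wE _ _ xy; rewrite in_rem xs orbT.
by case/andP.
Qed.

Lemma glueset_all (Q : pred (seq T)) s t E : uniq s -> uniq t ->
    (forall R R', perm_eq R R' -> Q R = Q R') ->
    (forall R, R \in glues op (map f s) (map g t) -> Q R) ->
  matchset E -> within s t E -> Q (glueset s t E).
Proof.
(* Count with [sum_matchings] the results that violate Q. *)
move=> us ut Qp Qg mE wE.
have := @sum_matchings nat s t (fun R => ~~ Q R) us ut
  (fun R R' p => congr1 (fun b => nat_of_bool (~~ b)) (Qp _ _ p)).
rewrite [RHS]big_seq [RHS]big1; last by move=> R RG; rewrite (Qg R RG).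
move/eqP; rewrite [X in X == _]big_mkcond sum_nat_eq0 => /forallP/(_ E) /=.
by rewrite mE wE /=; case: (Q _).
Qed.

End Matchings.

Lemma perm_enumeration (L L' : seq T) : perm_eq L L' ->
  exists (I : finType) (f : I -> T) (s s' : seq I),
    [/\ uniq s, perm_eq s s', L = map f s & L' = map f s'].
Proof.
rewrite perm_sym -[L]/(val (in_tuple L)) => /tuple_permP[p EL'].
exists 'I_(size L), (tnth (in_tuple L)), (enum 'I_(size L)),
  (map p (enum 'I_(size L))).
split.
- exact: enum_uniq.
- apply: uniq_perm; rewrite ?(map_inj_uniq (@perm_inj _ p)) ?enum_uniq // => i.
   rewrite mem_enum; symmetry; apply/mapP; exists (p^-1 i)%g.
    by rewrite mem_enum.
  by rewrite permKV.
- by rewrite /= map_tnth_enum.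
- by rewrite EL' /= -map_comp.
Qed.

(** Permuted lists enumerate one indexed family in two orders. Through [sum_matchings] both sums run
    over the same sets of edges, where the order of the indices no longer matters. *)
Lemma perm_glues (V : nmodType) L L' M M' (F : seq T -> V) :
    (forall R R', perm_eq R R' -> F R = F R') ->
    perm_eq L L' -> perm_eq M M' ->
  \sum_(R <- glues op L M) F R = \sum_(R <- glues op L' M') F R.
Proof.
move=> Fp /perm_enumeration[I [f [s [s' [us ss' -> ->]]]]].
case/perm_enumeration=> J [g [t [t' [ut tt' -> ->]]]].
rewrite -!sum_matchings -?(perm_uniq ss') -?(perm_uniq tt') //.
apply: eq_big => [E|E _].
  congr (_ && _); apply/withinP/withinP => h x y /h;
  by rewrite (perm_mem ss') (perm_mem tt').
by apply: Fp; rewrite /glueset !perm_cat ?perm_map ?perm_filter.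
Qed.

Lemma perm_splits (V : nmodType) L L' (H : seq T -> seq T -> V) :
    (forall X X' Y Y', perm_eq X X' -> perm_eq Y Y' -> H X Y = H X' Y') ->
    perm_eq L L' ->
  \sum_(p <- splits L) H p.1 p.2 = \sum_(p <- splits L') H p.1 p.2.
Proof.
move=> Hp /perm_enumeration[I [f [s [s' [us ss' -> ->]]]]].
rewrite -!sum_subsets -?(perm_uniq ss') //; apply: eq_big => [S|S _].
  by apply: eq_subset_r => x; apply: perm_mem.
by apply: Hp; rewrite perm_map ?perm_filter.
Qed.

End Enumeration.

Lemma map_glues (T T' : Type) (op : T -> T -> T) (op' : T' -> T' -> T')
    (h : T -> T') L M : {morph h : x y / op x y >-> op' x y} ->
  glues op' (map h L) (map h M) = map (map h) (glues op L M).
Proof.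
move=> hM; have picks_map N : picks (map h N)
    = [seq (h p.1, map h p.2) | p <- picks N].
  by elim: N => //= x N ->; rewrite -!map_comp.
elim: L M => //= u L IH M; rewrite map_cat IH -!map_comp; congr (_ ++ _).
rewrite map_flatten picks_map -!map_comp; congr flatten; apply: eq_map => p /=.
by rewrite IH -!map_comp; apply: eq_map => R /=; rewrite hM.
Qed.

Lemma map_splits (T T' : Type) (h : T -> T') L :
  splits (map h L) = [seq (map h p.1, map h p.2) | p <- splits L].
Proof. by elim: L => //= u L ->; rewrite map_cat -!map_comp. Qed.

Lemma perm_picks (T : eqType) (L : seq T) p :
  p \in picks L -> perm_eq L (p.1 :: p.2).
Proof.
elim: L p => //= x L IH p; rewrite inE => /predU1P[-> //|/mapP[q /IH Lq ->]] /=.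
by rewrite (perm_trans (y := [:: x, q.1 & q.2])) ?perm_cons //
  (perm_catCA [:: x] [:: q.1]).
Qed.

Lemma perm_split (T : eqType) (L : seq T) p :
  p \in splits L -> perm_eq L (p.1 ++ p.2).
Proof.
elim: L p => /= [p|u L IH p]; first by rewrite inE => /eqP->.
rewrite mem_cat => /orP[]/mapP[q /IH Lq ->] /=; first by rewrite perm_cons.
by rewrite perm_sym perm_catC /= perm_cons perm_catC perm_sym.
Qed.

(** * Words and their blocks *)

Section Words.
Implicit Types (a w u : word) (L M R B : seq word).

Definition isblock w := if w is x :: w' then all (leq x) w' else false.

(** These are the lists that enumerate an LR-decomposition in some order. *)
Definition good L := all isblock L && uniq (map (head 0) L).

(* The blocks of the LR-decomposition of [flatten B], from left to right. *)
Definition decr B :=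
  all isblock B && sorted (fun u w => head 0 w < head 0 u) B.

Lemma minletter_block w : isblock w -> minletter w = head 0 w.
Proof.
case: w => //= x w xw; rewrite /minletter /=; apply/minn_idPl.
elim: w xw => //= y w IH /andP[xy /IH h].
by rewrite leq_min xy.
Qed.

Lemma all_block w y : isblock w -> y \in w -> head 0 w <= y.
Proof.
by case: w => //= x w /allP xw; rewrite inE => /predU1P[-> //|/xw].
Qed.

(** The head of w is below all of a, hence a new minimum; no later letter of w is strictly below it,
    so there is no other. *)
Lemma lrpos_block a w : isblock w -> all (fun y => head 0 w < y) a ->
  lrpos (a ++ w) = rcons (lrpos a) (size a).
Proof.
case: w => // x w bw /= xa; rewrite /lrpos size_cat iotaD filter_cat add0n.
rewrite -cats1; congr (_ ++ _).
  apply/eq_in_filter => i; rewrite mem_iota add0n /= => ia.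
  by rewrite /lrmin nth_cat ia takel_cat // ltnW.
rewrite /= /lrmin nth_cat ltnn subnn /= take_size_cat // xa; congr (_ :: _).
apply/eqP; rewrite -(negbK (_ == _)) -has_filter; apply/hasPn => i.
rewrite mem_iota => /andP[ai ia]; rewrite nth_cat take_cat ltnNge (ltnW ai) /=.
have [k Ek] : exists k, i - size a = k.+1 by exists (i - size a).-1; lia.
have kw : k < size w by move: ia; lia.
rewrite Ek /=; apply/negP => /allP/(_ x); rewrite mem_cat inE eqxx orbT.
by move=> /(_ isT); rewrite ltnNge (allP bw) // mem_nth.
Qed.

Lemma lrdec_block a w : isblock w -> all (fun y => head 0 w < y) a ->
  lrdec (a ++ w) = w :: lrdec a.
Proof.
move=> bw wa; rewrite /lrdec (lrpos_block bw wa) size_cat.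
have lt p : p \in lrpos a -> p <= size a.
  by rewrite mem_filter mem_iota => /andP[_]; lia.
case: a wa lt => [|y a] wa lt.
  by rewrite /= drop0 take_size.
have [k [P EP]] : exists k P, lrpos (y :: a) = k :: P.
  by rewrite /lrpos /=; eauto.
rewrite EP in lt *; rewrite rcons_cons /= -rcons_cons zip_rcons ?size_rcons //.
rewrite map_rcons rev_rcons /= take_oversize ?size_cat // drop_size_cat //.
congr (_ :: rev _); apply/eq_in_map => -[p q] /(map_f snd) /=.
rewrite -/(unzip2 _) unzip2_zip ?size_rcons //.
rewrite mem_rcons inE => qP; congr drop; apply: (@takel_cat q _ (y :: a)).
by case/predU1P: qP => [->|qP]; rewrite ?leqnn // lt // inE qP orbT.
Qed.

Lemma decr_rcons B w : decr (rcons B w) ->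
  [/\ decr B, isblock w & all (fun y => head 0 w < y) (flatten B)].
Proof.
rewrite /decr all_rcons -cats1 => /andP[/andP[bw bB]].
rewrite sorted_pairwise; last by move=> ? ? ? /=; lia.
rewrite pairwise_cat => /and3P[/allrelP h sB _].
rewrite bB sorted_pairwise ?sB; last by move=> ? ? ? /=; lia.
split=> //; apply/allP => y /flattenP[u uB yu].
have := h u w uB; rewrite inE eqxx => /(_ isT) /leq_trans; apply.
by apply: all_block yu; apply: (allP bB).
Qed.

Lemma lrdec_flatten B : decr B -> lrdec (flatten B) = rev B.
Proof.
elim/last_ind: B => // B w IH /decr_rcons[dB bw wB].
by rewrite flatten_rcons lrdec_block // IH // rev_rcons.
Qed.

(** If the first block of B starts strictly lower than w, then w stands as a block of its own;
    otherwise w absorbs that block and remains a block. A tie is absorbed because left-to-right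
    minima are strict. *)
Lemma decr_absorb w B : isblock w -> decr B ->
  exists2 B', decr B' & w ++ flatten B = flatten B'.
Proof.
elim: B w => [|u B IH] w bw dB; first by exists [:: w]; rewrite /decr /= ?bw.
case: (ltnP (head 0 u) (head 0 w)) => [uw|wu].
  by exists [:: w, u & B] => //; move: dB; rewrite /decr /= bw uw.
move: dB; rewrite /decr /= => /andP[/andP[bu bB] sB].
rewrite catA; apply: IH; last by rewrite /decr bB (path_sorted sB).
case: w bw wu => //= x w xw xu; rewrite all_cat xw /=.
by apply/allP => y /(all_block bu); apply: leq_trans.
Qed.

Lemma decr_exists a : exists2 B, decr B & a = flatten B.
Proof.
elim: a => [|x a [B dB ->]]; first by exists [::].
exact: (@decr_absorb [:: x]).
Qed.

Lemma perm_good L L' : perm_eq L L' -> good L = good L'.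
Proof.
by move=> p; rewrite /good (perm_all _ p) (perm_uniq (perm_map _ p)).
Qed.

Lemma decr_good B : decr B -> good B.
Proof.
case/andP=> bB sB; rewrite /good bB /=.
apply: (@sorted_uniq _ (fun x y => y < x)); last by rewrite sorted_map.
  by move=> ? ? ?; lia.
by move=> ?; exact: ltnn.
Qed.

Lemma minletter_good L u : good L -> u \in L -> minletter u = head 0 u.
Proof. by case/andP=> /allP bL _ /bL; apply: minletter_block. Qed.

Lemma uniq_map_inj (T1 T2 : eqType) (f : T1 -> T2) s :
  uniq (map f s) -> {in s &, injective f}.
Proof.
elim: s => //= x s IH /andP[xs /IH inj] y z; rewrite !inE.
move=> /predU1P[->|ys] /predU1P[->|zs] // E; last exact: inj.
  by case/negP: xs; rewrite E map_f.
by case/negP: xs; rewrite -E map_f.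
Qed.

Lemma sort_good L B : good L -> perm_eq L B ->
  sort (fun v w => minletter w <= minletter v) L
  = sort (fun v w => minletter w <= minletter v) B.
Proof.
move=> gL pL; apply/perm_sort_inP => //.
- by move=> ? ? _ _; exact: leq_total.
- by move=> u v w _ _ _ /= uv wu; apply: leq_trans uv.
- move=> u v uL vL /=; rewrite -eqn_leq !(minletter_good gL) // => /eqP h.
  case/andP: gL => _ uL'.
  exact: (uniq_map_inj uL').
Qed.

Lemma sort_decr B : decr B ->
  sort (fun v w => minletter w <= minletter v) B = B.
Proof.
move=> dB; apply: sorted_sort.
  by move=> u v w /= uv wu; apply: leq_trans uv.
have gB := decr_good dB; case/andP: dB => _.
elim: B gB => //= u [|w B] //= IH gB /andP[wu sB].
rewrite !(minletter_good gB) ?inE ?eqxx ?orbT // ltnW //=; apply: IH => //.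
by move: gB; rewrite /good /= => /andP[/andP[_ ->] /andP[_ ->]].
Qed.

Lemma word_of_decr L B : decr B -> perm_eq L B -> word_of L = flatten B.
Proof.
move=> dB pL; rewrite /word_of (@sort_good L B) ?sort_decr //.
by rewrite (perm_good pL) decr_good.
Qed.

Lemma good_decr L : good L -> exists2 B, decr B & perm_eq L B.
Proof.
move=> gL; set le := fun v w => minletter w <= minletter v.
have pL : perm_eq L (sort le L) by rewrite perm_sym; apply/seq.permPl/perm_sort.
exists (sort le L) => //; have gB : good (sort le L) by rewrite -(perm_good pL).
have : sorted le (sort le L) by apply: sort_sorted => ? ?; exact: leq_total.
move: (sort le L) gB => B {pL} gB sB; rewrite /decr; case/andP: (gB) => -> _ /=.
elim: B gB sB => //= u [|w B] //= IH gB /andP[uw sB].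
have gB' : good (w :: B).
  by move: gB; rewrite /good /= => /andP[/andP[_ ->] /andP[_ ->]].
rewrite IH // andbT; move: uw.
rewrite /le !(minletter_good gB) ?inE ?eqxx ?orbT //.
rewrite leq_eqVlt => /orP[/eqP E|//].
by move: gB; rewrite /good /= E inE eqxx andbF.
Qed.

Lemma word_of_lrdec a : word_of (lrdec a) = a.
Proof.
have [B dB ->] := decr_exists a; rewrite (lrdec_flatten dB).
by apply: word_of_decr => //; rewrite perm_rev.
Qed.

Lemma good_lrdec a : good (lrdec a).
Proof.
have [B dB ->] := decr_exists a; rewrite (lrdec_flatten dB).
by rewrite (@perm_good _ B) ?decr_good // perm_rev.
Qed.

Lemma perm_lrdec_word_of L : good L -> perm_eq (lrdec (word_of L)) L.
Proof.
case/good_decr=> B dB pL; rewrite (word_of_decr dB pL) (lrdec_flatten dB).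
by rewrite perm_rev perm_sym.
Qed.

Lemma decr_map f B : {in flatten B &, {homo f : x y / x < y}} ->
  decr B -> decr (map (map f) B).
Proof.
move=> fB /andP[bB sB]; rewrite /decr.
have hd u : u \in B ->
    head 0 u \in flatten B /\ head 0 (map f u) = f (head 0 u).
  move=> uB; have := allP bB u uB; case: u uB => // x u uB _; split=> //=.
  by apply/flattenP; exists (x :: u); rewrite ?inE ?eqxx.
apply/andP; split.
  rewrite all_map; apply/allP => u uB /=; have := allP bB u uB.
  case: u uB => //= x u uB xu; rewrite all_map; apply/allP => y yu /=.
  have := allP xu y yu; rewrite leq_eqVlt => /orP[/eqP-> //|xy].
  by apply/ltnW/fB => //; apply/flattenP; exists (x :: u);
     rewrite ?inE ?eqxx ?yu ?orbT.
rewrite sorted_map; apply: (sub_in_sorted (P := mem B)) sB; last exact/allP.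
move=> u w uB wB /= wu; have [[uF ->] [wF ->]] := (hd u uB, hd w wB).
exact: fB.
Qed.

Section Relabelling.
Variables (f : nat -> nat) (L : seq word).
Hypothesis f_incr : {in flatten L &, {homo f : x y / x < y}}.
Hypothesis gL : good L.

Let decrL : exists B, [/\ decr B, decr (map (map f) B) & perm_eq L B].
Proof.
have [B dB pL] := good_decr gL; exists B; split=> //; apply: decr_map => //.
by move=> x y xB yB; apply: f_incr; rewrite (perm_mem (perm_flatten pL)).
Qed.

Lemma good_map : good (map (map f) L).
Proof.
by have [B [_ dB pL]] := decrL; rewrite (perm_good (perm_map _ pL)) decr_good.
Qed.

Lemma word_of_map : word_of (map (map f) L) = map f (word_of L).
Proof.
have [B [dB dB' pL]] := decrL.
rewrite (word_of_decr dB' (perm_map _ pL)) (word_of_decr dB pL).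
by rewrite map_flatten.
Qed.

End Relabelling.

Lemma good_shift m L : good L -> good (map (shift m) L).
Proof. by apply: good_map => x y _ _; rewrite ltn_add2l. Qed.

Lemma good_cat L M : good (L ++ M) -> good L /\ good M.
Proof.
by rewrite /good all_cat map_cat cat_uniq
  => /andP[/andP[-> ->] /and3P[-> _ ->]].
Qed.

Lemma glues_perm L M R : R \in glues cat L M ->
  perm_eq (flatten R) (flatten L ++ flatten M).
Proof.
elim: L M R => [|u L IH] M R; first by rewrite inE => /eqP->.
rewrite /= mem_cat => /orP[/mapP[R' /IH pR ->]|/flattenP[? /mapP[p pM ->]]].
  by rewrite /= -catA perm_cat2l.
case/mapP=> R' /IH pR -> /=; apply/seq.permP => P.
rewrite !count_cat (seq.permP pR) (seq.permP (perm_flatten (perm_picks pM))) /=.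
by rewrite !count_cat; lia.
Qed.

(** All letters of L are at most m and all letters of M exceed m, so an edge uv still starts with
    its minimum, the head of u, and no two heads coincide. *)
Lemma glues_good m L M R : good L -> good M ->
    all (leq^~ m) (flatten L) -> all (leq m.+1) (flatten M) ->
  R \in glues cat L M -> good R.
Proof.
case/andP=> bL uL /andP[bM uM] Lm Mm.
have: uniq (map (head 0) L ++ map (head 0) M).
  have hd N u : all isblock N -> u \in N -> head 0 u \in flatten N.
    move=> bN uN; have := allP bN u uN; case: u uN => //= x u uN _.
    by apply/flattenP; exists (x :: u); rewrite ?inE ?eqxx.
  rewrite cat_uniq uL uM andbT /=; apply/hasPn => _ /mapP[v vM ->].
  apply/mapP => -[u uL' E]; have := allP Lm _ (hd _ _ bL uL').
  by have := allP Mm _ (hd _ _ bM vM); rewrite /= E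
    => lt /(leq_trans lt); rewrite ltnn.
(* The heads of R form a sub-multiset of those of L and M. Stated with counts, this passes through
   the induction and yields uniqueness. *)
move=> uLM RLM; suff [bR cR] : all isblock R /\ forall P,
    count P (map (head 0) R) <= count P (map (head 0) L ++ map (head 0) M).
  rewrite /good bR /=; apply: count_mem_uniq => x.
  have : count_mem x (map (head 0) R) <= 1.
    by apply: leq_trans (cR _) _; rewrite count_uniq_mem // leq_b1.
  by rewrite -has_pred1 has_count; case: (count _ _) => [|[|n]].
elim: L M R {uL uM uLM} bL bM Lm Mm RLM => [|u L IH] M R.
  by move=> _ bM _ _; rewrite inE => /eqP->.
rewrite /= => /andP[bu bL] bM; rewrite all_cat => /andP[um Lm] Mm.
rewrite mem_cat => /orP[/mapP[R' hR' ->]|/flattenP[? /mapP[p pM ->]]].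
  have [bR cR] := IH _ _ bL bM Lm Mm hR'.
  by rewrite /= bu bR; split=> // P; rewrite leq_add2l.
case/mapP=> R' hR' ->; have pM' := perm_picks pM.
move: bM Mm; rewrite (perm_all _ pM') (perm_all _ (perm_flatten pM')) /=.
rewrite all_cat => /andP[bp bM] /andP[mp Mm].
have [bR cR] := IH _ _ bL bM Lm Mm hR'; rewrite /= bR andbT; split.
  case: u bu um => //= x u xu /andP[xm _]; rewrite all_cat xu.
  by apply/allP => y /(allP mp) /=; apply: leq_trans; rewrite ltnW.
move=> P; have := cR P.
rewrite !count_cat (seq.permP (perm_map (head 0) pM')) /=.
by case: u bu {um} => //= x u _; lia.
Qed.

(* An extension of [word_of] that is invariant under permutation even when    *)
(* two words of L have the same minimum.                                      *)
Definition cword L := word_of (sort (relpre choice.pickle leq) L).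

Lemma cword_perm L L' : perm_eq L L' -> cword L = cword L'.
Proof.
move=> pL; congr word_of; apply/perm_sortP => //.
- by move=> u v; exact: leq_total.
- by move=> u v w /=; exact: leq_trans.
- by move=> u v /=; rewrite -eqn_leq => /eqP; exact: (pcan_inj choice.pickleK).
Qed.

Lemma cword_good L : good L -> cword L = word_of L.
Proof.
case/good_decr=> B dB pL; rewrite (word_of_decr dB pL).
apply: word_of_decr dB _.
by apply: perm_trans pL; apply/seq.permPl/perm_sort.
Qed.

End Words.

(** * Parkization *)

Section Parkization.
Implicit Types (w : word).

Notation cnt w i := (count (leq^~ i) w).

(* The total amount by which [park w] lowers the letter x of w: parkization   *)
(* replaces x by [pk w x], for one relabelling [pk w] increasing on w.        *)
Definition gap w x := \max_(i < x) (i - cnt w i).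

Definition pk w x := x - gap w x.

Definition submulti w' w := forall P : pred nat, count P w' <= count P w.

Lemma submulti_mem w' w x : submulti w' w -> x \in w' -> x \in w.
Proof.
by move=> sub; rewrite -!has_pred1 !has_count => /leq_trans; apply; apply: sub.
Qed.

Lemma leq_gap w x i : i < x -> i - cnt w i <= gap w x.
Proof.
by move=> ix; apply: (@leq_bigmax _ (fun i : 'I_x => i - cnt w i) (Ordinal ix)).
Qed.

Lemma gap_leq w x n :
  (forall i, i < x -> i - cnt w i <= n) -> gap w x <= n.
Proof. by move=> h; apply/bigmax_leqP => i _; apply: h. Qed.

Lemma gap_le_letter w x : gap w x <= x.-1.
Proof. by apply: gap_leq => i; lia. Qed.

Lemma count_leD w i j : i <= j ->
  cnt w j = cnt w i + count (fun x => i < x <= j) w.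
Proof. by move=> ij; elim: w => //= x w ->; lia. Qed.

Lemma defectP w : cnt w (defect w) < defect w
  /\ forall i, i < defect w -> i <= cnt w i.
Proof.
rewrite /defect; case: ex_minnP => d h m; split=> // i.
by rewrite ltnNge; apply: contraR; rewrite -ltnNge => /m.
Qed.

(** From x to y the largest deficiency grows by less than y - x, because the occurrence of x in w is
    itself counted from index x on. *)
Lemma pk_incr w : {in w &, {homo pk w : x y / x < y}}.
Proof.
move=> x y xw yw xy; rewrite /pk.
have gx := gap_le_letter w x.
suff : gap w y < gap w x + (y - x) by lia.
suff : gap w y <= (gap w x + (y - x)).-1 by lia.
apply: gap_leq => i iy; case: (ltnP i x) => [ix|xi].
  by have := leq_gap w ix; lia.
have := count_leD w xi.
have c0 : 0 < count_mem x w by rewrite -has_count has_pred1.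
case: x xw xy gx xi c0 => [|x] xw xy gx xi c0.
  have : count_mem 0 w <= cnt w i by apply: sub_count => z /eqP->.
  by lia.
have := leq_gap w (ltnSn x); have := count_leD w (leqnSn x).
have : count_mem x.+1 w <= count (fun z => x < z <= x.+1) w.
  by apply: sub_count => z /eqP-> /=; lia.
lia.
Qed.

Section Step.
Variables (w w' : word).
Hypothesis dw : defect w != (size w).+1.
Hypothesis sub : submulti w' w.

Let d := defect w.
Let dec x := if d < x then x.-1 else x.

(** The value d does not occur in w, so a step deletes an empty value from the scale, in the part w'
    as well. In w' the deficiency at d exceeds the one at every smaller i: between i and d there are
    at most d - 1 - i letters of w. So when x > d, both x and its gap drop by exactly one; when x <
    d neither changes. *)
Lemma pk_dec x : x \in w' -> pk (map dec w') (dec x) = pk w' x.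
Proof.
move=> xw'; have [cd id] := defectP w; rewrite -/d in cd id.
have c' i : cnt (map dec w') i = if i < d then cnt w' i else cnt w' i.+1.
  by rewrite count_map; case: ifP => di; apply: eq_count => z /=;
    rewrite /dec; case: (ltnP d z); lia.
have d0 : 0 < d by lia.
(* Minimality of d leaves at least d - 1 letters below d, while fewer than d letters are at most d;
   hence none equals d. *)
have cD : cnt w d.-1 = d.-1 /\ count (fun z => d.-1 < z <= d) w = 0.
  by have := id d.-1; have := count_leD w (leq_pred d); lia.
have cD' : cnt w' d = cnt w' d.-1.
  have := count_leD w' (leq_pred d).
  by have := sub (fun z => d.-1 < z <= d); lia.
have dx : x != d.
  apply: contraL (submulti_mem sub xw') => /eqP->; rewrite -has_pred1 has_count.
  have : count_mem d w <= count (fun z => d.-1 < z <= d) w.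
    by apply: sub_count => z /eqP->; lia.
  by lia.
rewrite /pk; case: (ltngtP d x) dx => // [lt|gt] _; last first.
  have -> : dec x = x by rewrite /dec ltnNge (ltnW gt).
  congr (x - _); apply: eq_bigr => i _; rewrite c'.
  by have := ltn_ord i; case: ifP; lia.
have -> : dec x = x.-1 by rewrite /dec lt.
suff -> : gap w' x = (gap (map dec w') x.-1).+1 by lia.
apply/eqP; rewrite eqn_leq; apply/andP; split.
  apply: gap_leq => i ix; case: (ltngtP i d) => [lid|ldi|->].
  - by have := @leq_gap (map dec w') x.-1 i; rewrite c' lid; lia.
  - have := @leq_gap (map dec w') x.-1 i.-1; rewrite c'.
    by case: ifP => [|_]; first lia; rewrite prednK; lia.
  - have := @leq_gap (map dec w') x.-1 d.-1; rewrite c'.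
    by case: ifP => [_|]; lia.
have gd := leq_gap w' lt; have := sub (leq^~ d) => sd.
suff : gap (map dec w') x.-1 <= (gap w' x).-1 by lia.
apply: gap_leq => i ix; rewrite c'; case: ifP => di.
  have := count_leD w (ltnW di); have := count_leD w' (ltnW di).
  by have := sub (fun z => i < z <= d); have := id i di; lia.
by have := @leq_gap w' x i.+1; lia.
Qed.

End Step.

Lemma pk_id w : defect w = (size w).+1 -> {in w, pk w =1 id}.
Proof.
move=> dw x xw; have [_ id] := defectP w; rewrite dw in id.
have xs : x <= size w.
  have : all (leq^~ (size w)) w.
    by rewrite all_count eqn_leq count_size id.
  by move/allP; apply.
suff : gap w x <= 0 by rewrite /pk; lia.
by apply: gap_leq => i ix; have := id i; lia.
Qed.

Lemma park_pk w : park w = map (pk w) w.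
Proof.
have [k] := ubnP (sumn w); elim: k w => // k IH w lek.
rewrite parkE; case: eqP => [dw|/eqP dw].
  by rewrite -[LHS]map_id; apply/eq_in_map => x xw; rewrite pk_id.
rewrite IH; last by have := sumn_park_step dw; lia.
rewrite /park_step -map_comp; apply/eq_in_map => x xw /=.
exact: pk_dec.
Qed.

(** The induction follows the parkization of w, not that of w': by [pk_dec] each of its steps,
    applied to w', leaves the values of [pk] on w' unchanged. *)
Lemma park_map_pk w w' : submulti w' w -> park (map (pk w) w') = park w'.
Proof.
have [k] := ubnP (sumn w); elim: k w w' => // k IH w w' lek sub.
have [dw|/eqP dw] := defect w =P (size w).+1.
  congr park; rewrite -[RHS]map_id; apply/eq_in_map => x xw.
  by rewrite pk_id //; apply: submulti_mem xw.
pose dec x := if defect w < x then x.-1 else x.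
have -> : map (pk w) w' = map (pk (park_step w)) (map dec w').
  rewrite -map_comp; apply/eq_in_map => x xw /=.
  by rewrite pk_dec //; apply: submulti_mem xw.
rewrite IH.
- rewrite !park_pk -map_comp; apply/eq_in_map => x xw /=; exact: pk_dec.
- by have := sumn_park_step dw; lia.
- by move=> P; rewrite /park_step !count_map; apply: sub.
Qed.

Lemma gap_perm w w' : perm_eq w w' -> gap w =1 gap w'.
Proof. by move=> p x; apply: eq_bigr => i _; rewrite (seq.permP p). Qed.

Lemma pk_perm w w' : perm_eq w w' -> pk w =1 pk w'.
Proof. by move=> p x; rewrite /pk (gap_perm p). Qed.

Section Concatenation.
Variables (a w v : word).
Hypotheses (pa : parking a) (sub : submulti w a) (pv : positive v).

Lemma pk_catl x : x \in w -> pk (w ++ shift (size a) v) x = pk w x.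
Proof.
move=> xw; congr (x - _); apply: eq_bigr => i _; congr (_ - _).
rewrite count_cat count_map [X in _ + X](@eq_count _ _ pred0).
  by rewrite count_pred0 addn0.
have xa : x <= size a.
  case/andP: pa => /allP h _.
  by have /h/andP[] := submulti_mem sub xw.
by move=> z /=; have := ltn_ord i; lia.
Qed.

(** As [a] is a parking function, the deficiency of its part w at any i up to m = size a is at most
    m - size w, the number of letters left out. This value is reached at m, and beyond m it adds to
    the deficiency of v. *)
Lemma pk_catr y : y \in v ->
  pk (w ++ shift (size a) v) (size a + y) = size w + pk v y.
Proof.
move=> yv; have y0 : 0 < y by apply: (allP pv).
set m := size a; have [_ ca] := parkingP _ pa.
have wa : size w <= m by have := sub predT; rewrite !count_predT.
have cE i : cnt (w ++ shift m v) i = cnt w i + count (fun z => m + z <= i) v.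
  by rewrite count_cat count_map.
have cS j : count (fun z => m + z <= m + j) v = cnt v j.
  by apply: eq_count => z; lia.
have cw i : m <= i -> cnt w i = size w.
  move=> mi; have := count_predC (leq^~ i) w.
  have := sub (predC (leq^~ i)); have := count_predC (leq^~ i) a.
  have := ca m (leqnn _); have := count_leD a mi; rewrite -/m; lia.
have c0 : cnt v 0 = 0.
  apply/eqP; rewrite eqn0Ngt -has_count; apply/hasPn => z /(allP pv) /=; lia.
suff E : gap (w ++ shift m v) (m + y) = m - size w + gap v y.
  by rewrite /pk E; have := gap_le_letter v y; lia.
(* The bound is attained at index m: all of w lies there, and nothing of the shifted v since v is
   positive. *)
have K : m - size w <= gap (w ++ shift m v) (m + y).
  have := @leq_gap (w ++ shift m v) (m + y) (m + 0).
  by rewrite cE cS c0 cw; lia.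
apply/eqP; rewrite eqn_leq; apply/andP; split.
  apply: gap_leq => i iy; rewrite cE; case: (ltnP i m) => im.
    have := count_predC (leq^~ i) w; have := sub (predC (leq^~ i)).
    by have := count_predC (leq^~ i) a; have := ca i (ltnW im);
       rewrite -/m; lia.
  have [j Ej] : exists j, i = m + j by exists (i - m); lia.
  rewrite Ej cS cw ?leq_addr //; have := @leq_gap v y j; lia.
suff : gap v y <= gap (w ++ shift m v) (m + y) - (m - size w) by lia.
apply: gap_leq => j jy; have := @leq_gap (w ++ shift m v) (m + y) (m + j).
by rewrite cE cS cw ?leq_addr //; lia.
Qed.

End Concatenation.
End Parkization.

(** * Free modules and antipodes *)

Section FreeModuleTheory.
Local Open Scope ring_scope.
Variable K : fieldType.

Section Sums.
Variables (U V : lmodType K) (phi : U -> V).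
Hypothesis lphi : linear phi.

Lemma linear_sumP (I : Type) (r : seq I) (F : I -> U) :
  phi (\sum_(i <- r) F i) = \sum_(i <- r) phi (F i).
Proof.
pose fl : {linear U -> V} :=
  HB.pack phi (GRing.isLinear.Build K U V *:%R phi lphi).
exact: (linear_sum fl).
Qed.

Lemma linearZP c x : phi (c *: x) = c *: phi x.
Proof.
pose fl : {linear U -> V} :=
  HB.pack phi (GRing.isLinear.Build K U V *:%R phi lphi).
exact: (linearZ_LR fl).
Qed.

Lemma linearBP x y : phi (x - y) = phi x - phi y.
Proof.
pose fl : {linear U -> V} :=
  HB.pack phi (GRing.isLinear.Build K U V *:%R phi lphi).
exact: (linearB fl).
Qed.

End Sums.

Section Linext.
Variables (B : choiceType) (V : lmodType K).

Lemma linextEw (f : B -> V) (d : {fset B}) (x : {malg K[B]}) :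
  (msupp x `<=` d)%fset -> linext f x = \sum_(b <- d) x@_b *: f b.
Proof.
move=> xd; rewrite /linext (big_fset_incl _ xd) // => b _ /mcoeff_outdom ->.
by rewrite scale0r.
Qed.

Lemma linext_is_linear (f : B -> V) : linear (linext f).
Proof.
move=> c x y; pose d := (msupp x `|` (msupp y `|` msupp (c *: x + y)))%fset.
have dx : (msupp x `<=` d)%fset by apply: fsubsetUl.
have dy : (msupp y `<=` d)%fset by rewrite /d fsetUCA fsubsetUl.
have dxy : (msupp (c *: x + y) `<=` d)%fset by rewrite /d fsetUA fsubsetUr.
rewrite (linextEw f dx) (linextEw f dy) (linextEw f dxy).
rewrite scaler_sumr -big_split /=; apply: eq_bigr => b _.
by rewrite mcoeffD mcoeffZ scalerDl scalerA.
Qed.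

Lemma linextU (f : B -> V) b : linext f << b >> = f b.
Proof.
by rewrite /linext msuppU oner_eq0 big_seq_fset1 mcoeffUU scale1r.
Qed.

Lemma linear_eq (phi psi : {malg K[B]} -> V) : linear phi -> linear psi ->
  (forall b, phi << b >> = psi << b >>) -> phi =1 psi.
Proof.
suff E (f : {malg K[B]} -> V) : linear f -> f =1 linext (fun b => f << b >>).
  move=> lphi lpsi eqb x; rewrite (E phi) // (E psi) //.
  by apply: eq_bigr => b _; rewrite eqb.
move=> lf x; rewrite {1}(monalgE x) (linear_sumP lf); apply: eq_bigr => b _.
rewrite -(linearZP lf); congr f.
by apply/malgP => k; rewrite mcoeffZ !mcoeffU mulr_natr.
Qed.

End Linext.

Section Bilext.
Variables (A B : choiceType) (V : lmodType K) (f : A -> B -> V).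

Lemma bilextUU a b : bilext f << a >> << b >> = f a b.
Proof. by rewrite /bilext !linextU. Qed.

Lemma bilext_linearl y : linear (bilext f ^~ y).
Proof. exact: linext_is_linear. Qed.

Lemma bilext_linearr x : linear (bilext f x).
Proof.
have E y : bilext f x y = \sum_(a <- msupp x) x@_a *: linext (f a) y by [].
move=> c y z; rewrite !E scaler_sumr -big_split /=; apply: eq_bigr => a _.
rewrite linext_is_linear.
by rewrite scalerDr !scalerA mulrC.
Qed.

End Bilext.

Lemma linear_comp (U V W : lmodType K) (g : V -> W) (f : U -> V) :
  linear f -> linear g -> linear (fun x => g (f x)).
Proof. by move=> lf lg c x y; rewrite lf lg. Qed.

Lemma bilext_sum (A B : choiceType) (V : lmodType K) (f : A -> B -> V)
    (I J : Type) (r : seq I) (t : seq J) F G :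
  bilext f (\sum_(i <- r) F i) (\sum_(j <- t) G j)
  = \sum_(i <- r) \sum_(j <- t) bilext f (F i) (G j).
Proof.
rewrite (linear_sumP (bilext_linearl f _)); apply: eq_bigr => i _.
exact: (linear_sumP (bilext_linearr f _)).
Qed.

Lemma mul_tens_tens (B : choiceType)
    (mu : {malg K[B]} -> {malg K[B]} -> {malg K[B]}) :
  (forall x, linear (mu x)) -> (forall y, linear (mu^~ y)) ->
  forall x y, mul_tens mu (tens x y) = mu x y.
Proof.
move=> lr ll x y; move: x; apply: linear_eq => //.
  by apply: linear_comp (bilext_linearl _ y) (linext_is_linear _).
move=> a; move: y; apply: linear_eq => //.
  by apply: linear_comp (bilext_linearr _ _) (linext_is_linear _).
by move=> b; rewrite /tens bilextUU /mul_tens linextU.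
Qed.

End FreeModuleTheory.

(* The antipode is the convolution inverse of [id = conv_one + aug_id], that  *)
(* is the geometric series [\sum_k (-1)^k aug_id^k]; [takeuchi k] is its k-th *)
(* partial sum, which is stationary in degrees less than k.                   *)
Section ConnectedAntipode.
Local Open Scope ring_scope.
Variables (K : fieldType) (B : choiceType).
Notation H := {malg K[B]}.
Notation HH := {malg K[(B * B)%type]}.
Variables (mu : H -> H -> H) (e : B) (Delta : H -> HH) (eps : H -> K).
Variables (deg : B -> nat) (r : B -> seq (B * B)).

Hypotheses (mulA : is_algebra mu << e >>) (lDelta : linear Delta)
  (leps : scalar eps).
Hypothesis DeltaE : forall b, Delta << b >> = \sum_(p <- r b) << p >>.
Hypothesis epsE : forall b, eps << b >> = (b == e)%:R.
Hypothesis r_coassoc : forall b (F : B -> B -> B -> H),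
  \sum_(p <- r b) \sum_(q <- r p.1) F q.1 q.2 p.2
  = \sum_(p <- r b) \sum_(q <- r p.2) F p.1 q.1 q.2.
Hypothesis r_counitl : forall b (F : B -> H),
  \sum_(p <- r b | p.1 == e) F p.2 = F b.
Hypothesis r_counitr : forall b (F : B -> H),
  \sum_(p <- r b | p.2 == e) F p.1 = F b.
Hypothesis r_deg : forall b p, p \in r b -> (deg p.1 + deg p.2)%N = deg b.
Hypothesis deg0 : forall b, deg b = 0%N -> b = e.

Implicit Types (f g h : B -> H).

Let mu_linr x : linear (mu x). Proof. by case: mulA => -[]. Qed.
Let mu_linl y : linear (mu^~ y). Proof. by case: mulA => -[]. Qed.
Let mu0l y : mu 0 y = 0.
Proof. by have := linearZP (mu_linl y) 0 0; rewrite !scale0r. Qed.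
Let mu0r x : mu x 0 = 0.
Proof. by have := linearZP (mu_linr x) 0 0; rewrite !scale0r. Qed.
Let mu1l y : mu << e >> y = y. Proof. by case: mulA => _ _ ->. Qed.
Let mu1r x : mu x << e >> = x. Proof. by case: mulA => _ _ _ ->. Qed.

Definition conv f g b : H := \sum_(p <- r b) mu (f p.1) (g p.2).

Definition conv_one b : H := if b == e then << e >> else 0.
Definition aug_id b : H := if b == e then 0 else << b >>.

Lemma conv_ext f f' g g' : f =1 f' -> g =1 g' -> conv f g =1 conv f' g'.
Proof. by move=> Ef Eg b; apply: eq_bigr => p _; rewrite Ef Eg. Qed.

Lemma convA f g h : conv (conv f g) h =1 conv f (conv g h).
Proof.
move=> b; rewrite /conv.
under eq_bigr do rewrite (linear_sumP (mu_linl _)).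
under [RHS]eq_bigr do rewrite (linear_sumP (mu_linr _)).
rewrite (r_coassoc b (fun x y z => mu (mu (f x) (g y)) (h z))).
by apply: eq_bigr => p _; apply: eq_bigr => q _; case: mulA => _ ->.
Qed.

Lemma conv1l g : conv conv_one g =1 g.
Proof.
move=> b; rewrite -[RHS](r_counitl b g) [RHS]big_mkcond; apply: eq_bigr => p _.
by rewrite /conv_one; case: eqP => _; rewrite ?mu0l ?mu1l.
Qed.

Lemma conv1r f : conv f conv_one =1 f.
Proof.
move=> b; rewrite -[RHS](r_counitr b f) [RHS]big_mkcond; apply: eq_bigr => p _.
by rewrite /conv_one; case: eqP => _; rewrite ?mu0r ?mu1r.
Qed.

Lemma convBl f f' g b : conv (fun b => f b - f' b) g b
  = conv f g b - conv f' g b.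
Proof.
by rewrite -sumrB; apply: eq_bigr => p _; rewrite (linearBP (mu_linl _)).
Qed.

Lemma convBr f g g' b : conv f (fun b => g b - g' b) b
  = conv f g b - conv f g' b.
Proof.
by rewrite -sumrB; apply: eq_bigr => p _; rewrite (linearBP (mu_linr _)).
Qed.

Fixpoint takeuchi k : B -> H :=
  if k is k'.+1 then fun b => conv_one b - conv (takeuchi k') aug_id b
  else fun=> 0.

(** The partial sums are polynomials in [aug_id]. They are built by multiplying on the right, and
    commutation turns the left inverse into a right one. *)
Lemma takeuchi_comm k : conv (takeuchi k) aug_id =1 conv aug_id (takeuchi k).
Proof.
elim: k => [|k IH] b.
  by rewrite /conv !big1 // => p _; rewrite /= ?mu0l ?mu0r.
rewrite /= convBl convBr conv1l conv1r; congr (_ - _).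
by rewrite (conv_ext IH (frefl aug_id)) convA.
Qed.

(** As [aug_id] vanishes at e, the only element of degree zero, f is evaluated in degrees strictly
    below that of b. *)
Lemma conv_aug_idr f f' b : (forall b', (deg b' < deg b)%N -> f b' = f' b') ->
  conv f aug_id b = conv f' aug_id b.
Proof.
move=> eqf; rewrite /conv !big_seq; apply: eq_bigr => p pr.
rewrite /aug_id; case: eqP => [_|/eqP ne]; first by rewrite !mu0r.
have : (0 < deg p.2)%N.
  by rewrite lt0n; apply: contra_neq ne; apply: deg0.
by move=> d0; rewrite eqf // -(r_deg pr) -[X in (X < _)%N]addn0 ltn_add2l.
Qed.

Lemma conv_aug_idl f f' b : (forall b', (deg b' < deg b)%N -> f b' = f' b') ->
  conv aug_id f b = conv aug_id f' b.
Proof.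
move=> eqf; rewrite /conv !big_seq; apply: eq_bigr => p pr.
rewrite /aug_id; case: eqP => [_|/eqP ne]; first by rewrite !mu0l.
have : (0 < deg p.1)%N.
  by rewrite lt0n; apply: contra_neq ne; apply: deg0.
by move=> d0; rewrite eqf // -(r_deg pr) -[X in (X < _)%N]add0n ltn_add2r.
Qed.

Lemma takeuchi_stable k b : (deg b < k)%N ->
  takeuchi k b = takeuchi (deg b).+1 b.
Proof.
elim/ltn_ind: k b => -[//|k] IH b; rewrite ltnS => bk.
rewrite /=; congr (_ - _); apply: conv_aug_idr => b' b'b.
rewrite (IH k) //; last exact: leq_trans b'b bk.
by rewrite (IH (deg b)).
Qed.

Definition antipode_basis b : H := takeuchi (deg b).+1 b.

Lemma conv_antipodel b : conv antipode_basis (fun b => << b >>) b = conv_one b.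
Proof.
have -> : conv antipode_basis (fun b => << b >>) b
    = antipode_basis b + conv antipode_basis aug_id b.
  rewrite -[X in X + _]conv1r -big_split /=; apply: eq_bigr => p _.
  rewrite /conv_one /aug_id; case: eqP => [->|_].
    by rewrite mu0r addr0.
  by rewrite mu0r add0r.
(* Below the degree of b the antipode agrees with [takeuchi (deg b)], whose convolution with
   [aug_id] is the term subtracted in the definition of [antipode_basis b]. *)
rewrite (@conv_aug_idr _ (takeuchi (deg b))) ?subrK // => b' b'b.
by rewrite [RHS]takeuchi_stable.
Qed.

Lemma conv_antipoder b : conv (fun b => << b >>) antipode_basis b = conv_one b.
Proof.
have -> : conv (fun b => << b >>) antipode_basis b
    = antipode_basis b + conv aug_id antipode_basis b.
  rewrite -[X in X + _]conv1l -big_split /=; apply: eq_bigr => p _.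
  rewrite /conv_one /aug_id; case: eqP => [->|_].
    by rewrite mu0l addr0.
  by rewrite mu0l add0r.
rewrite (@conv_aug_idl _ (takeuchi (deg b))) -?takeuchi_comm ?subrK //
  => b' b'b.
by rewrite [RHS]takeuchi_stable.
Qed.

Lemma connected_antipode : exists S, is_antipode mu << e >> Delta eps S.
Proof.
have tensl (f g : H -> H) : linear (tensmap f g) by apply: linext_is_linear.
have mtl : linear (mul_tens mu) by apply: linext_is_linear.
have leu : linear (fun x => eps x *: << e >> : H).
  by move=> c x y; rewrite leps scalerDl scalerA.
have E0 b : conv_one b = eps << b >> *: << e >>.
  by rewrite /conv_one epsE; case: eqP; rewrite ?scale1r ?scale0r.
have E (f g : H -> H) b : mul_tens mu (tensmap f g (Delta << b >>))
    = conv (fun b => f << b >>) (fun b => g << b >>) b.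
  rewrite DeltaE (linear_sumP (tensl f g)) (linear_sumP mtl).
  by apply: eq_bigr => p _; rewrite /tensmap linextU mul_tens_tens.
exists (linext antipode_basis); split; first exact: linext_is_linear.
- apply: linear_eq => // [|b].
    by apply: linear_comp mtl; apply: linear_comp (tensl _ _).
  rewrite E -E0 -conv_antipodel; apply: conv_ext => // b'.
  by rewrite linextU.
- apply: linear_eq => // [|b].
    by apply: linear_comp mtl; apply: linear_comp (tensl _ _).
  rewrite E -E0 -conv_antipoder; apply: conv_ext => // b'.
  by rewrite linextU.
Qed.

End ConnectedAntipode.

(** * Products and coproducts of parking functions *)

Section Basis.
Implicit Types (a b : pf) (L M N R X : seq word).

Definition pf_of L : pf := insubd pf_nil (cword L).
Definition pf_park_of L : pf := insubd pf_nil (park (cword L)).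

Lemma pf_of_perm L L' : perm_eq L L' -> pf_of L = pf_of L'.
Proof. by move=> p; rewrite /pf_of (cword_perm p). Qed.

Lemma pf_park_of_perm L L' : perm_eq L L' -> pf_park_of L = pf_park_of L'.
Proof. by move=> p; rewrite /pf_park_of (cword_perm p). Qed.

Lemma pf_of_lrdec a : pf_of (lrdec a) = a.
Proof. by rewrite /pf_of cword_good ?good_lrdec // word_of_lrdec valKd. Qed.

Lemma park_id a : park a = a.
Proof.
have [pa ca] := parkingP _ (pf_parking a).
rewrite parkE; case: eqP => // /eqP dw; have := defect_le a.
by have [] := defectP a; have := ca (defect a); lia.
Qed.

Lemma pf_park_of_lrdec a : pf_park_of (lrdec a) = a.
Proof.
by rewrite /pf_park_of cword_good ?good_lrdec // word_of_lrdec park_id valKd.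
Qed.

Definition gluings a b :=
  glues cat (lrdec a) (map (shift (size a)) (lrdec b)).

Lemma parking_perm w w' : perm_eq w w' -> parking w -> parking w'.
Proof.
move=> p /parkingP[pw cw]; apply/parkingP; split.
  by rewrite /positive -(perm_all _ p).
by move=> i; rewrite -(perm_size p) -(seq.permP p); apply: cw.
Qed.

Lemma flatten_shift m L : flatten (map (shift m) L) = shift m (flatten L).
Proof. by rewrite /shift -map_flatten. Qed.

Lemma matching0 a b :
  is_matching (set0 : {set 'I_(nblocks a) * 'I_(nblocks b)}).
Proof. by apply/forall_inP => e; rewrite inE. Qed.

(** This is a rearrangement of the word glued along the empty matching. *)
Lemma parking_cat a b : parking (a ++ shift (size a) b).
Proof.
apply: (parking_perm _ (glue_parking
  (Sub set0 (matching0 a b) : matching a b))).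
exact: perm_glue_word.
Qed.

Section Gluing.
Variables (a b : pf) (R : seq word).
Hypothesis Rab : R \in gluings a b.

Lemma gluing_perm : perm_eq (flatten R) (a ++ shift (size a) b).
Proof.
apply: (perm_trans (glues_perm Rab)); apply: perm_cat; first exact: perm_lrdec.
by rewrite flatten_shift perm_map ?perm_lrdec.
Qed.

Lemma gluing_good : good R.
Proof.
apply: (@glues_good (size a)) Rab; rewrite ?good_shift ?good_lrdec //.
  rewrite (perm_all _ (perm_lrdec a)); apply/allP => x xa.
  by case/andP: (pf_parking a) => /allP/(_ x xa)/andP[].
rewrite flatten_shift all_map (perm_all _ (perm_lrdec b)).
apply/allP => x xb /=.
by have := allP (pf_positive b) x xb; lia.
Qed.

Lemma pf_of_gluing : pf_of R = word_of R :> word.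
Proof.
rewrite /pf_of cword_good ?gluing_good // val_insubd.
rewrite (parking_perm _ (parking_cat a b)) // perm_sym.
exact: perm_trans (perm_word_of _) gluing_perm.
Qed.

Lemma size_gluing : size (pf_of R) = size a + size b.
Proof.
rewrite pf_of_gluing (perm_size (perm_word_of R)) (perm_size gluing_perm).
by rewrite size_cat size_map.
Qed.

Lemma perm_lrdec_gluing : perm_eq (lrdec (pf_of R)) R.
Proof. by rewrite pf_of_gluing perm_lrdec_word_of ?gluing_good. Qed.

End Gluing.

(** The blocks of a subword, retained only through their letters: this is all that parkization sees,
    and it is inherited by splittings. *)
Definition part L a := good L /\ submulti (flatten L) a.

Lemma part_lrdec a : part (lrdec a) a.
Proof. by split=> [|P]; rewrite ?good_lrdec // (seq.permP (perm_lrdec a)). Qed.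

Lemma part_split L a p : part L a -> p \in splits L -> part p.1 a /\ part p.2 a.
Proof.
case=> gL sL /perm_split pL; move: gL.
rewrite (perm_good pL) => /good_cat[g1 g2].
split; split=> // P; apply: leq_trans (sL P);
by rewrite (seq.permP (perm_flatten pL)) flatten_cat count_cat
  ?leq_addl ?leq_addr.
Qed.

Section Part.
Variables (L : seq word) (a : pf).
Hypothesis La : part L a.

Notation f := (pk (flatten L)).

Let gL : good L. Proof. by case: La. Qed.

Lemma part_positive : positive (flatten L).
Proof.
apply/allP => x xL; apply: (allP (pf_positive a)).
by case: La => _ /submulti_mem; apply.
Qed.

Lemma pf_park_of_part : pf_park_of L = map f (word_of L) :> word.
Proof.
rewrite /pf_park_of cword_good // val_insubd park_parking; last first.
  by rewrite /positive (perm_all _ (perm_word_of L)); apply: part_positive.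
by rewrite park_pk; apply: eq_map; apply/pk_perm/perm_word_of.
Qed.

Lemma size_pf_park_of : size (pf_park_of L) = size (flatten L).
Proof. by rewrite pf_park_of_part size_map (perm_size (perm_word_of L)). Qed.

Lemma perm_lrdec_part : perm_eq (lrdec (pf_park_of L)) (map (map f) L).
Proof.
rewrite pf_park_of_part -word_of_map //; last exact: pk_incr.
by apply: perm_lrdec_word_of; apply: good_map => //; apply: pk_incr.
Qed.

End Part.

Lemma pf_park_of_map L a X : part L a -> part X a ->
    submulti (flatten X) (flatten L) ->
  pf_park_of (map (map (pk (flatten L))) X) = pf_park_of X.
Proof.
move=> [gL _] [gX _] sX.
have inc : {in flatten X &, {homo pk (flatten L) : x y / x < y}}.
  by move=> x y xX yX; apply: pk_incr; apply: submulti_mem sX _.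
rewrite /pf_park_of !cword_good ?good_map // word_of_map // park_map_pk //.
by move=> P; rewrite (seq.permP (perm_word_of X)).
Qed.

Local Open Scope ring_scope.
Variable V : nmodType.

Lemma map_block a : map (block a) (enum 'I_(nblocks a)) = lrdec a.
Proof.
rewrite -[in RHS](mkseq_nth [::] (lrdec a)) /mkseq -val_enum_ord -map_comp.
exact: eq_map.
Qed.

Lemma image_filter (I : finType) (f : I -> word) (A : {set I}) :
  [seq f i | i in A] = [seq f i | i <- enum I & i \in A].
Proof.
rewrite /image_mem /enum_mem -filter_predI; congr map.
by apply: eq_filter => i; rewrite /= andbT.
Qed.

(** Bridge from the matchings of the definition to lists: an instance of [sum_matchings] with full
    enumerations of the block indices. *)
Lemma sum_gluings a b (F : pf -> V) :
  \sum_(T : matching a b) F (pf_glue T) = \sum_(R <- gluings a b) F (pf_of R).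
Proof.
pose f (i : 'I_(nblocks a)) := block a i.
pose g (j : 'I_(nblocks b)) := shift (size a) (block b j).
have fE : map f (enum 'I_(nblocks a)) = lrdec a by apply: map_block.
have gE : map g (enum 'I_(nblocks b)) = map (shift (size a)) (lrdec b).
  by rewrite -[in RHS]map_block -map_comp.
have FE : forall R R', perm_eq R R' -> F (pf_of R) = F (pf_of R').
  by move=> R R' /pf_of_perm->.
have := sum_matchings cat f g (enum_uniq 'I_(nblocks a))
  (enum_uniq 'I_(nblocks b)) FE.
rewrite fE gE => <-.
have wE (E : {set 'I_(nblocks a) * 'I_(nblocks b)}) :
    within (enum 'I_(nblocks a)) (enum 'I_(nblocks b)) E.
  by apply/withinP => i j _; rewrite !mem_enum.
under [RHS]eq_bigl do rewrite wE andbT.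
rewrite [RHS](big_sub (fun E => matchset E)).
apply: eq_bigr => T _; congr F; apply: val_inj => /=.
have E : glueset cat f g (enum 'I_(nblocks a)) (enum 'I_(nblocks b)) (val T)
    = glue_blocks T.
  rewrite /glueset /glue_blocks !image_filter /f /g.
  congr (_ ++ (_ ++ _)); congr map; apply: eq_filter => i; by rewrite !inE.
rewrite E; have gT : good (glue_blocks T).
  rewrite -E; apply: glueset_all (valP T) (wE _); rewrite ?enum_uniq //.
    exact: perm_good.
  by rewrite fE gE => R; apply: gluing_good.
by rewrite /pf_of cword_good // val_insubd; have := glue_parking T => /= ->.
Qed.

Lemma sum_pf_park a (H : pf -> pf -> V) :
  \sum_(S : {set 'I_(nblocks a)}) H (pf_park S) (pf_park (~: S))
  = \sum_(p <- splits (lrdec a)) H (pf_park_of p.1) (pf_park_of p.2).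
Proof.
have := @sum_subsets _ V _ (block a) _ (fun X Y =>
  H (pf_park_of X) (pf_park_of Y)) (enum_uniq 'I_(nblocks a)).
rewrite map_block => <-.
have pE S : pf_park S
    = pf_park_of [seq block a i | i <- enum 'I_(nblocks a) & i \in S].
  have gS : good [seq block a i | i <- enum 'I_(nblocks a) & i \in S].
    have : good (map (block a) (enum 'I_(nblocks a))).
      by rewrite map_block good_lrdec.
    case/andP=> /allP bL uL.
    apply/andP; split; first by apply/allP => w /mapP[i]; rewrite mem_filter
      => /andP[_ iI] ->; apply/bL/map_f.
    by apply: subseq_uniq uL; rewrite !map_subseq // filter_subseq.
  apply: val_inj; rewrite val_insubd cword_good //= /subword image_filter.
  by rewrite park_parking //; have := subword_positive S;
     rewrite /subword image_filter.
apply: eq_big => [S|S _].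
  by symmetry; apply/subsetP => i; rewrite mem_enum.
rewrite !pE; congr (H _ (pf_park_of (map _ _))).
by apply: eq_filter => i; rewrite inE.
Qed.

(** All the gluings R have the same letters w, so one relabelling [pk w] parkizes them all. On L it
    acts as the parkization of L; on the shifted N it acts as that of N, with the shift reduced from
    the size of [a] to that of L. *)
Lemma sum_gluings_part L a N b (F : pf -> V) : part L a -> part N b ->
  \sum_(R <- glues cat L (map (shift (size a)) N)) F (pf_park_of R)
  = \sum_(R <- gluings (pf_park_of L) (pf_park_of N)) F (pf_of R).
Proof.
move=> La Nb; set m := size a; set w := flatten L ++ shift m (flatten N).
have FE : forall R R', perm_eq R R' -> F (pf_of R) = F (pf_of R').
  by move=> R R' /pf_of_perm->.
have [gL sL] := La; have [gN sN] := Nb.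
have pN := part_positive Nb.
rewrite /gluings (perm_glues _ FE (perm_lrdec_part La)
  (perm_map _ (perm_lrdec_part Nb))) (size_pf_park_of La).
have -> : map (map (pk (flatten L))) L = map (map (pk w)) L.
  apply/eq_in_map => u uL; apply/eq_in_map => x xu; rewrite pk_catl //.
    exact: pf_parking.
  by apply/flattenP; exists u.
have -> : map (shift (size (flatten L))) (map (map (pk (flatten N))) N)
    = map (map (pk w)) (map (shift m) N).
  rewrite -!map_comp; apply/eq_in_map => u uN /=; rewrite /shift -!map_comp.
  apply/eq_in_map => x xu /=; rewrite pk_catr //; first exact: pf_parking.
  by apply/flattenP; exists u.
rewrite (map_glues (op := cat)) ?big_map; last by move=> u v; rewrite map_cat.
rewrite !big_seq; apply: eq_bigr => R RLN.
have pR : perm_eq (flatten R) w.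
  by rewrite -[w]/(_ ++ _) /m -flatten_shift glues_perm.
have gR : good R.
  apply: (@glues_good m) RLN; rewrite ?good_shift //.
    apply/allP => x /(submulti_mem sL) xa.
    by case/andP: (pf_parking a) => /allP/(_ x xa)/andP[].
  rewrite flatten_shift all_map; apply/allP => x /(allP pN) /=; lia.
have inc : {in flatten R &, {homo pk w : x y / (x < y)%N}}.
  by move=> x y; rewrite !(perm_mem pR); apply: pk_incr.
congr F; rewrite /pf_park_of /pf_of !cword_good ?good_map // word_of_map //.
rewrite park_pk; congr insubd; apply: eq_map; apply: pk_perm.
exact: perm_trans (perm_word_of R) pR.
Qed.

(** Parkizing L before splitting it has no effect, by [pf_park_of_map] applied to each side. *)
Lemma sum_splits_part L a (H : pf -> pf -> V) : part L a ->
  \sum_(q <- splits (lrdec (pf_park_of L))) H (pf_park_of q.1) (pf_park_of q.2)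
  = \sum_(q <- splits L) H (pf_park_of q.1) (pf_park_of q.2).
Proof.
move=> La; rewrite (perm_splits
  (H := fun X Y => H (pf_park_of X) (pf_park_of Y))
  _ (perm_lrdec_part La)).
  rewrite map_splits big_map !big_seq; apply: eq_bigr => q qL /=.
  have [q1 q2] := part_split La qL.
  have sub X : X = q.1 \/ X = q.2 -> submulti (flatten X) (flatten L).
    move=> Xq P; rewrite (seq.permP (perm_flatten (perm_split qL))).
    by rewrite flatten_cat count_cat; case: Xq => ->;
       rewrite ?leq_addl ?leq_addr.
  by rewrite !(pf_park_of_map La) //; apply: sub; [right | left].
by move=> X X' Y Y' /pf_park_of_perm-> /pf_park_of_perm->.
Qed.

Lemma gluings_assoc a b c (F : pf -> V) :
  \sum_(R <- gluings a b) \sum_(Q <- gluings (pf_of R) c) F (pf_of Q)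
  = \sum_(R <- gluings b c) \sum_(Q <- gluings a (pf_of R)) F (pf_of Q).
Proof.
have FE : forall R R', perm_eq R R' -> F (pf_of R) = F (pf_of R').
  by move=> R R' /pf_of_perm->.
rewrite big_seq; under eq_bigr => R Rab do rewrite /gluings (size_gluing Rab)
  (perm_glues _ FE (perm_lrdec_gluing Rab) (perm_refl _)).
rewrite -big_seq glues_assoc; last exact: catA.
have -> : map (shift (size a + size b)) (lrdec c)
    = map (shift (size a)) (map (shift (size b)) (lrdec c)).
  rewrite -map_comp; apply: eq_map => w /=; rewrite /shift -map_comp.
  by apply: eq_map => x /=; rewrite addnA.
rewrite (map_glues (op := cat)) ?big_map;
  last by move=> u v; rewrite /shift map_cat.
rewrite !big_seq; apply: eq_bigr => R Rbc.
by rewrite -(perm_glues _ FE (perm_refl _)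
  (perm_map _ (perm_lrdec_gluing Rbc))).
Qed.

(** After [splits_glues], each side is a gluing of a part of [a] with a part of b, and
    [sum_gluings_part] moves parkization inside the gluing, once per side. *)
Lemma splits_gluings a b (H : pf -> pf -> V) :
  \sum_(R <- gluings a b) \sum_(p <- splits (lrdec (pf_of R)))
    H (pf_park_of p.1) (pf_park_of p.2)
  = \sum_(p <- splits (lrdec a)) \sum_(q <- splits (lrdec b))
      \sum_(R <- gluings (pf_park_of p.1) (pf_park_of q.1))
      \sum_(R' <- gluings (pf_park_of p.2) (pf_park_of q.2))
        H (pf_of R) (pf_of R').
Proof.
pose H' X Y := H (pf_park_of X) (pf_park_of Y).
have HE : forall X X' Y Y', perm_eq X X' -> perm_eq Y Y' -> H' X Y = H' X' Y'.
  by move=> X X' Y Y'; rewrite /H' => /pf_park_of_perm-> /pf_park_of_perm->.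
rewrite big_seq; under eq_bigr => R Rab do
  rewrite (perm_splits HE (perm_lrdec_gluing Rab)).
rewrite -big_seq splits_glues !big_seq; apply: eq_bigr => p pa.
have [p1 p2] := part_split (part_lrdec a) pa.
rewrite map_splits big_map !big_seq; apply: eq_bigr => q qb /=.
have [q1 q2] := part_split (part_lrdec b) qb.
rewrite -(sum_gluings_part (fun x => \sum_(R' <- _) H x (pf_of R')) p1 q1).
apply: eq_bigr => R _.
by rewrite -(sum_gluings_part (H (pf_park_of R)) p2 q2).
Qed.

Lemma splits_parts_coassoc a (F : pf -> pf -> pf -> V) :
  \sum_(p <- splits (lrdec a)) \sum_(q <- splits (lrdec (pf_park_of p.1)))
    F (pf_park_of q.1) (pf_park_of q.2) (pf_park_of p.2)
  = \sum_(p <- splits (lrdec a)) \sum_(q <- splits (lrdec (pf_park_of p.2)))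
    F (pf_park_of p.1) (pf_park_of q.1) (pf_park_of q.2).
Proof.
rewrite big_seq [RHS]big_seq; under eq_bigr => p pa.
  have [p1 _] := part_split (part_lrdec a) pa.
  rewrite (sum_splits_part (fun x y => F x y (pf_park_of p.2)) p1); over.
under [RHS]eq_bigr => p pa.
  have [_ p2] := part_split (part_lrdec a) pa.
  rewrite (sum_splits_part (fun x y => F (pf_park_of p.1) x y) p2); over.
rewrite -!big_seq (splits_coassoc (lrdec a) (fun X Y Z =>
  F (pf_park_of X) (pf_park_of Y) (pf_park_of Z))).
by [].
Qed.

End Basis.

(** * Coassociativity and counit laws on basis vectors *)

Section CoproductTerms.
Local Open Scope ring_scope.
Implicit Types (a b : pf) (L M : seq word).

Lemma splits_nill (V : nmodType) L (F : seq word -> V) :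
  \sum_(p <- splits L | p.1 == [::]) F p.2 = F L.
Proof.
elim: L F => [|u L IH] F; first by rewrite big_mkcond big_seq1 eqxx.
by rewrite /= big_cat !big_map /= big_pred0_eq add0r (IH (fun X => F (u :: X))).
Qed.

Lemma splits_nilr (V : nmodType) L (F : seq word -> V) :
  \sum_(p <- splits L | p.2 == [::]) F p.1 = F L.
Proof.
elim: L F => [|u L IH] F; first by rewrite big_mkcond big_seq1 eqxx.
by rewrite /= big_cat !big_map /= big_pred0_eq addr0 (IH (fun X => F (u :: X))).
Qed.

Lemma pf_park_of_eq0 L a : part L a -> (pf_park_of L == pf_nil) = (L == [::]).
Proof.
move=> La; rewrite -val_eqE /= -size_eq0 (size_pf_park_of La) size_eq0.
by case: La => /andP[+ _] _; case: L => // -[].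
Qed.

Definition comul_terms a : seq (pf * pf) :=
  [seq (pf_park_of p.1, pf_park_of p.2) | p <- splits (lrdec a)].

Lemma comul_terms_coassoc (V : nmodType) a (F : pf -> pf -> pf -> V) :
  \sum_(p <- comul_terms a) \sum_(q <- comul_terms p.1) F q.1 q.2 p.2
  = \sum_(p <- comul_terms a) \sum_(q <- comul_terms p.2) F p.1 q.1 q.2.
Proof.
rewrite !big_map; under eq_bigr do rewrite big_map /=.
under [RHS]eq_bigr do rewrite big_map /=.
exact: splits_parts_coassoc.
Qed.

Lemma comul_terms_counitl (V : nmodType) a (F : pf -> V) :
  \sum_(p <- comul_terms a | p.1 == pf_nil) F p.2 = F a.
Proof.
rewrite big_map /= -[in RHS](pf_park_of_lrdec a).
rewrite -(splits_nill (lrdec a) (fun X => F (pf_park_of X))).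
rewrite big_seq_cond [RHS]big_seq_cond; apply: eq_bigl => p.
case pa: (p \in _) => //=; have [p1 _] := part_split (part_lrdec a) pa.
exact: (pf_park_of_eq0 p1).
Qed.

Lemma comul_terms_counitr (V : nmodType) a (F : pf -> V) :
  \sum_(p <- comul_terms a | p.2 == pf_nil) F p.1 = F a.
Proof.
rewrite big_map /= -[in RHS](pf_park_of_lrdec a).
rewrite -(splits_nilr (lrdec a) (fun X => F (pf_park_of X))).
rewrite big_seq_cond [RHS]big_seq_cond; apply: eq_bigl => p.
case pa: (p \in _) => //=; have [_ p2] := part_split (part_lrdec a) pa.
exact: (pf_park_of_eq0 p2).
Qed.

Lemma size_comul_terms a p : p \in comul_terms a ->
  (size p.1 + size p.2)%N = size a.
Proof.
case/mapP=> q qa -> /=; have [q1 q2] := part_split (part_lrdec a) qa.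
rewrite (size_pf_park_of q1) (size_pf_park_of q2) -size_cat -flatten_cat.
by rewrite -(perm_size (perm_flatten (perm_split qa)))
  (perm_size (perm_lrdec a)).
Qed.

End CoproductTerms.

(** * The Hopf algebra axioms *)

Section PFSymHopf.
Local Open Scope ring_scope.
Variable K : fieldType.
Implicit Types (a b c : pf).

Notation mu := (@pfsym_mul K).
Notation one := (pfsym_one K).
Notation Delta := (@pfsym_comul K).
Notation eps := (@pfsym_counit K).

Lemma glues_nilr (L : seq word) : glues cat L [::] = [:: L].
Proof. by elim: L => //= u L ->. Qed.

(** The separate clauses for the empty word agree with the general formula, so later arguments need
    no case distinction. *)
Lemma mul_basisE a b : mul_basis K a b = \sum_(R <- gluings a b) << pf_of R >>.
Proof.
rewrite /mul_basis; case: eqP => [->|_].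
  rewrite /gluings /= big_seq1; congr << _ >>.
  rewrite -[LHS]pf_of_lrdec; congr pf_of; rewrite -[LHS]map_id.
  by apply: eq_map => w; rewrite /shift -[LHS]map_id; apply: eq_map => x.
case: eqP => [->|_]; last first.
  exact: (sum_gluings a b (fun c => << c >>)).
by rewrite /gluings /= glues_nilr big_seq1 pf_of_lrdec.
Qed.

Lemma mulUU a b : mu << a >> << b >> = \sum_(R <- gluings a b) << pf_of R >>.
Proof. by rewrite /pfsym_mul bilextUU mul_basisE. Qed.

Lemma comulU a : Delta << a >> = \sum_(p <- comul_terms a) << p >>.
Proof.
rewrite /pfsym_comul linextU big_map.
exact: (@sum_pf_park _ a (fun x y => << (x, y) >>)).
Qed.

Lemma counitU a : eps << a >> = (a == pf_nil)%:R.
Proof. exact: (@linextU K _ K^o). Qed.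

Lemma mu_linearl y : linear (mu^~ y). Proof. exact: bilext_linearl. Qed.
Lemma mu_linearr x : linear (mu x). Proof. exact: bilext_linearr. Qed.
Lemma Delta_linear : linear Delta. Proof. exact: linext_is_linear. Qed.
Lemma eps_linear : scalar eps. Proof. exact: (@linext_is_linear K _ K^o). Qed.

Lemma pfsym_algebra : is_algebra mu one.
Proof.
split.
- by split; [exact: mu_linearr | exact: mu_linearl].
- move=> x y z; move: x; apply: linear_eq => [||a].
  + exact: mu_linearl.
  + by apply: linear_comp (mu_linearl z); apply: mu_linearl.
  move: y; apply: linear_eq => [||b].
  + by apply: linear_comp (mu_linearr _); apply: mu_linearl.
  + by apply: linear_comp (mu_linearl z); apply: mu_linearr.
  move: z; apply: linear_eq => [||c].
  + by apply: linear_comp (mu_linearr _); apply: mu_linearr.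
  + exact: mu_linearr.
  rewrite !mulUU (linear_sumP (mu_linearr _)) (linear_sumP (mu_linearl _)).
  under eq_bigr do rewrite mulUU.
  under [RHS]eq_bigr do rewrite mulUU.
  by rewrite (gluings_assoc a b c (fun d => << d >>)).
- apply: linear_eq => [||a]; [exact: mu_linearr | by [] |].
  by rewrite /pfsym_mul bilextUU /mul_basis eqxx.
- apply: linear_eq => [||a]; [exact: mu_linearl | by [] |].
  rewrite /pfsym_mul bilextUU /mul_basis eqxx.
  by case: eqP => // ->.
Qed.

Lemma tens_suml (A B : choiceType) I (r : seq I) (F : I -> {malg K[A]})
    (y : {malg K[B]}) :
  tens (\sum_(i <- r) F i) y = \sum_(i <- r) tens (F i) y.
Proof. exact: (linear_sumP (bilext_linearl _ y)). Qed.

Lemma tens_sumr (A B : choiceType) I (r : seq I) (x : {malg K[A]})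
    (F : I -> {malg K[B]}) :
  tens x (\sum_(i <- r) F i) = \sum_(i <- r) tens x (F i).
Proof. exact: (linear_sumP (bilext_linearr _ x)). Qed.

Lemma tensUU (A B : choiceType) (a : A) (b : B) :
  tens << a >> << b >> = << (a, b) >> :> {malg K[(A * B)%type]}.
Proof. exact: bilextUU. Qed.

Lemma tensmap_comul (A B : choiceType) (f : pfsym K -> {malg K[A]})
    (g : pfsym K -> {malg K[B]}) a :
  tensmap f g (Delta << a >>)
  = \sum_(p <- comul_terms a) tens (f << p.1 >>) (g << p.2 >>).
Proof.
rewrite comulU /tensmap (linear_sumP (linext_is_linear _)).
by apply: eq_bigr => p _; rewrite linextU.
Qed.

Lemma pfsym_coassoc x :
  tens_assoc (tensmap Delta id (Delta x)) = tensmap id Delta (Delta x).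
Proof.
move: x; apply: linear_eq => [||a].
- by do 2! apply: linear_comp (linext_is_linear _); apply: Delta_linear.
- by apply: linear_comp (linext_is_linear _); apply: Delta_linear.
rewrite !tensmap_comul /tens_assoc (linear_sumP (linext_is_linear _)).
under eq_bigr => p _.
  rewrite comulU tens_suml (linear_sumP (linext_is_linear _)).
  under eq_bigr do rewrite tensUU linextU /=.
  over.
rewrite (comul_terms_coassoc a (fun x y z => << (x, (y, z)) >>)).
apply: eq_bigr => p _; rewrite comulU tens_sumr.
by apply: eq_bigr => -[q1 q2] _; rewrite tensUU.
Qed.

Lemma pfsym_coalgebra : is_coalgebra Delta eps.
Proof.
split; first by split; [exact: Delta_linear | exact: eps_linear].
- exact: pfsym_coassoc.
- apply: linear_eq => [||a] //.
    by apply: linear_comp (linext_is_linear _); apply: Delta_linear.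
  rewrite comulU (linear_sumP (linext_is_linear _)).
  rewrite -[RHS](comul_terms_counitl a (fun x => << x >>)) [RHS]big_mkcond.
  apply: eq_bigr => p _; rewrite linextU counitU.
  by case: eqP; rewrite ?scale1r ?scale0r.
- apply: linear_eq => [||a] //.
    by apply: linear_comp (linext_is_linear _); apply: Delta_linear.
  rewrite comulU (linear_sumP (linext_is_linear _)).
  rewrite -[RHS](comul_terms_counitr a (fun x => << x >>)) [RHS]big_mkcond.
  apply: eq_bigr => p _; rewrite linextU counitU.
  by case: eqP; rewrite ?scale1r ?scale0r.
Qed.

Lemma pfsym_comulM x y : Delta (mu x y) = tens_mul mu (Delta x) (Delta y).
Proof.
move: x; apply: linear_eq => [||a].
- by apply: linear_comp Delta_linear; apply: mu_linearl.
- by apply: linear_comp (bilext_linearl _ _); apply: Delta_linear.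
move: y; apply: linear_eq => [||b].
- by apply: linear_comp Delta_linear; apply: mu_linearr.
- by apply: linear_comp (bilext_linearr _ _); apply: Delta_linear.
rewrite mulUU (linear_sumP Delta_linear) !comulU /tens_mul bilext_sum.
under eq_bigr do rewrite comulU big_map /=.
rewrite (splits_gluings a b (fun x y => << (x, y) >>)) big_map.
apply: eq_bigr => p _; rewrite big_map; apply: eq_bigr => q _ /=.
rewrite bilextUU /= !mulUU tens_suml; apply: eq_bigr => R _.
by rewrite tens_sumr; apply: eq_bigr => R' _; rewrite tensUU.
Qed.

Lemma pfsym_counitM x y : eps (mu x y) = eps x * eps y.
Proof.
move: x; apply: (@linear_eq K _ K^o) => [||a].
- by move=> c x x'; rewrite mu_linearl eps_linear.
- by move=> c x x'; rewrite eps_linear mulrDl -mulrA.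
move: y; apply: (@linear_eq K _ K^o) => [||b].
- by move=> c y y'; rewrite mu_linearr eps_linear.
- by move=> c y y'; rewrite eps_linear mulrDr mulrCA.
rewrite mulUU (@linear_sumP K _ K^o _ eps_linear) !counitU.
have [->|a0] := eqVneq a pf_nil.
  have := mul_basisE pf_nil b; rewrite /mul_basis eqxx => /(congr1 eps).
  by rewrite counitU (@linear_sumP K _ K^o _ eps_linear) mul1r => <-.
(* When [a] is nonempty, every term of the product is at least as long as [a], so the counit kills
   it. *)
rewrite mul0r big_seq big1 // => R /size_gluing sR; rewrite counitU.
case: eqP sR => // -> /esym/eqP; rewrite addn_eq0 size_eq0 => /andP[/eqP a0' _].
by case/eqP: a0; apply: val_inj.
Qed.

Lemma pfsym_bialgebra : is_bialgebra mu one Delta eps.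
Proof.
split; [exact: pfsym_algebra | exact: pfsym_coalgebra | split | split].
- exact: pfsym_comulM.
- have E : pf_park_of [::] = pf_nil by apply: pf_park_of_lrdec pf_nil.
  by rewrite /pfsym_one comulU /comul_terms /= big_seq1 E tensUU.
- exact: pfsym_counitM.
- by rewrite counitU eqxx.
Qed.

(** Complementation is an involution on the subsets of blocks, and it swaps the two tensor
    factors. *)
Lemma pfsym_cocommutative : is_cocommutative Delta.
Proof.
apply: linear_eq => [||a].
- by apply: linear_comp (linext_is_linear _); apply: Delta_linear.
- exact: Delta_linear.
rewrite /pfsym_comul linextU /tens_swap (linear_sumP (linext_is_linear _)).
rewrite [RHS](reindex_inj (@setC_inj _)); apply: eq_bigr => S _.
by rewrite linextU setCK.
Qed.

End PFSymHopf.

Theorem theorem3p1 (K : fieldType) (charK : [pchar K]%R =i pred0) :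
  is_hopf_algebra (@pfsym_mul K) (pfsym_one K)
                  (@pfsym_comul K) (@pfsym_counit K)
  /\ is_cocommutative (@pfsym_comul K).
Proof.
split; last exact: pfsym_cocommutative; split; first exact: pfsym_bialgebra.
(* The grading is by length, and the empty word is the only parking function of degree zero. *)
apply: (@connected_antipode K pf _ pf_nil _ _ (fun a => size a) comul_terms).
- exact: pfsym_algebra.
- exact: Delta_linear.
- exact: eps_linear.
- exact: comulU.
- exact: counitU.
- by move=> b F; apply: comul_terms_coassoc.
- by move=> b F; apply: comul_terms_counitl.
- by move=> b F; apply: comul_terms_counitr.
- exact: size_comul_terms.
- by move=> b /size0nil E; apply: val_inj.
Qed.
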